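(* Assume that $Z$ is a densely defined linear operator in a complete (Hausdorff) locally convex space $\mathbf{X}$ and $t>0$. Then the operator $Z$ possesses a closure and its closure is the generator of an $lC_0$-semigroup if and only if there exists a function $F\in\mathcal{F}_{\mathbf{X}}$ such that: (i) $\mathcal{D}(F'_{ef}(0))\supset\mathcal{D}(Z)$ and $F'_{ef}(0)g=Zg$ for $g\in\mathcal{D}(Z)$; (ii) $\mathcal{D}({F^*}'(0))$ is *-dense in $\mathbf{X}^*$; (iii) for any $s>0$ and $f\in\mathbf{X}$, every subsequence of the sequence $\{F(\tfrac tn)^{[ns]}f\}_{n\in\mathbb{N}}$ has a weakly convergent subsequence; (iv) there exists a dense linear subspace $\mathbf{A}\subseteq\mathcal{D}(Z)$ of $\mathbf{X}$ such that for any $f\in\mathbf{A}$ and $s\ge0$ there exists a sequence $\{f_n^s\}_{n=1}^\infty$, $f_n^s\in\mathcal{D}(\overline{Z})$, such that $$w\text{-}\lim_{n\to\infty}\left(F(\tfrac tn)^{[ns]}f-f_n^s\right)=0\quad\text{and}\quad w\text{-}\lim_{n\to\infty}\left(F(\tfrac tn)^{[ns]}Zf-\overline{Z}f_n^s\right)=0.$$ Furthermore, if conditions (i)–(iv) are satisfied, then $\exp(t\overline{Z})f=\lim_{n\to\infty}F(t/n)^nf$ for each $f\in\mathbf{X}$.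
   Context: $\mathbf{X}$ is over $\mathbb{T}\in\{\mathbb{R},\mathbb{C}\}$ with topology generated by semi-norms $\|\cdot\|_\alpha$, $\alpha\in\Omega$. $\mathcal{L}(\mathbf{X})$ is the space of bounded linear operators in $\mathbf{X}$ with the topology of pointwise convergence; $I$ is the identity; $\mathcal{D}(C)$ is the domain of $C$; $[\cdot]$ is the integer part; $w\text{-}\lim$ is the limit in the weak topology $\sigma(\mathbf{X},\mathbf{X}^* )$. A family $G_\beta\in\mathcal{L}(\mathbf{X})$, $\beta\in\Gamma$, is equicontinuous if for any $\alpha\in\Omega$ there are finitely many $\alpha_1,\dots,\alpha_n\in\Omega$ and $b_1,\dots,b_n>0$ with $\sup_\beta\|G_\beta x\|_\alpha\le\sum_i b_i\|x\|_{\alpha_i}$ for all $x\in\mathbf{X}$. For $F:[0,\infty)\to\mathcal{L}(\mathbf{X})$ and $s\ge0$ put $\mathbf{B}^F_s=\{F(\tfrac dn)^m : md/n\le s,\ n,m\in\mathbb{N},\ d\ge0\}$. $\mathcal{E}_{\mathbf{X}}$ is the set of $F:[0,\infty)\to\mathcal{L}(\mathbf{X})$ with $F(0)=I$ and $\mathbf{B}^F_s$ equicontinuous for every $s\ge0$. Many-valued effective derivative: $\mathcal{D}(F'_{mef}(0))$ is the set of $f\in\mathbf{X}$ for which there is a family $\{f_s\}_{s\ge0}$ in $\mathbf{X}$ such that $\lim_{h\to0}f_h=f$ and $\lim_{h\to0}h^{-1}(F(h)-F(0))f_h$ exists (limits as $h\to 0$, $h>0$); $F'_{mef}(0)f$ is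 the set of all $g\in\mathbf{X}$ arising as the second limit for some such family. $\mathcal{F}_{\mathbf{X}}$ is the set of $F\in\mathcal{E}_{\mathbf{X}}$ with $\mathcal{D}(F'_{mef}(0))$ dense in $\mathbf{X}$. For $F\in\mathcal{F}_{\mathbf{X}}$ each $F'_{mef}(0)f$ consists of one element, and the effective derivative $F'_{ef}(0):\mathcal{D}(F'_{mef}(0))\to\mathbf{X}$ is the linear map with $F'_{ef}(0)f\in F'_{mef}(0)f$. A linear operator is closable (possesses a closure) if the closure of its graph in $\mathbf{X}\times\mathbf{X}$ is the graph of a linear operator, its closure $\overline{Z}$; condition (i) with $F\in\mathcal{F}_{\mathbf{X}}$ implies that $Z$ is closable, so that $\overline{Z}$ in (iv) makes sense. $\mathbf{X}^*$ is the space of continuous linear functionals with the strong topology (semi-norms $f\mapsto\sup_{x\in A}|f(x)|$, $A\subset\mathbf{X}$ bounded). $F^*(s)=(F(s))^*$. The strong derivative at $0$ of $S:[0,\infty)\to\mathcal{L}(\mathbf{E})$ is $S'(0)\psi=\lim_{h\to0}h^{-1}(S(h)\psi-S(0)\psi)$ with domain $\mathcal{D}(S'(0))$ the set of $\psi\in\mathbf{E}$ for which the limit exists; for $S=F^*$ one takes $\mathbf{E}=\mathbf{X}^*$. A set $A\subset\mathbf{X}^*$ is *-dense in $\mathbf{X}^*$ if for each $\phi\in\mathbf{X}^*$ there is a sequence $\phi_k\in A$ with $\lim_k\phi_k(x)=\phi(x)$ for each $x$ in the completion of $\mathbf{X}$. An $lC_0$-semigroup is a continuous function $T:[0,\infty)\to\mathcal{L}(\mathbf{X})$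 with $T(0)=I$, $T(l+m)=T(l)T(m)$ for $l,m\ge0$, and $T\in\mathcal{E}_{\mathbf{X}}$. Its generator is its strong derivative $T'(0)$; if $Z$ is the generator of $T$, one writes $T(t)=\exp(tZ)$. *)

(* Defs.v *)
From HB Require Import structures.
From mathcomp Require Import all_boot all_order all_algebra.
From mathcomp Require Import all_classical all_reals all_analysis.
From mathcomp Require Export complex.

Set Implicit Arguments.
Unset Strict Implicit.
Unset Printing Implicit Defensive.

Import Order.TTheory GRing.Theory Num.Theory.
Import numFieldNormedType.Exports.

Local Open Scope classical_set_scope.
Local Open Scope ring_scope.

Variant scalar_kind := RealScalars | ComplexScalars.

Definition scalar_field (R : realType) (T : scalar_kind) : numFieldType :=
  match T with RealScalars => R | ComplexScalars => R[i] end.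

Definition of_real (R : realType) (T : scalar_kind) : R -> scalar_field R T :=
  match T with RealScalars => id | ComplexScalars => real_complex R end.
Arguments of_real {R T}.

Section LocallyConvex.
Context (K : numFieldType) (X : tvsType K) (Omega : Type).

(* As for norms in MathComp, seminorms take their values in the scalar field
   (where [0 <= z] forces z to be real). *)
Definition seminorm (q : X -> K) : Prop :=
  [/\ forall x, 0 <= q x,
      forall x y, q (x + y) <= q x + q y
    & forall (a : K) x, q (a *: x) = `|a| * q x].

(* The uniform structure of a [tvsType] need not be translation invariant, so
   it is the uniform structure, and not merely the topology, that is required
   to be the one given by the seminorms. *)
Definition generating_seminorms (p : Omega -> X -> K) : Prop :=
  (forall a, seminorm (p a)) /\
  forall A : set (X * X), entourage A <->
    exists n (al : 'I_n -> Omega) (e : K), 0 < e /\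
      forall x y, (forall i, p (al i) (x - y) < e) -> A (x, y).

Definition seminorm_bounded (p : Omega -> X -> K) (A : set X) : Prop :=
  forall a, exists M : K, forall x, A x -> p a x <= M.

Definition equicontinuous_ops (p : Omega -> X -> K) (G : set (X -> X)) : Prop :=
  forall a, exists n (al : 'I_n -> Omega) (b : 'I_n -> K),
    (forall i, 0 < b i) /\
    forall g, G g -> forall x, p a (g x) <= \sum_(i < n) b i * p (al i) x.

End LocallyConvex.

Definition complete_space (T : uniformType) : Prop :=
  forall F : set_system T, ProperFilter F -> cauchy F -> exists x : T, F --> x.

Section Operators.
Context (K : numFieldType) (X : tvsType K).

(* L(X): "bounded" is read as continuous, i.e. as the seminorm estimate
   p a (G x) <= \sum_i b i * p (al i) x. Members of E_X are continuous anyway,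
   by equicontinuity of the set B^F_s, which contains F(s). *)
Record bounded_op := BoundedOp {
  op_linear :> {linear X -> X};
  op_continuous : continuous op_linear }.

HB.instance Definition _ := gen_eqMixin bounded_op.
HB.instance Definition _ := gen_choiceMixin bounded_op.

HB.instance Definition _ := Topological.copy bounded_op
  (initial_topology (fun G : bounded_op => (G : X -> X) : {ptws X -> X})).

Definition is_subspace (V : lmodType K) (A : set V) : Prop :=
  A 0 /\ forall (a : K) u v, A u -> A v -> A (a *: u + v).

(* A linear operator, with arbitrary domain, is identified with its graph. *)
Definition linear_operator (Z : set (X * X)) : Prop :=
  is_subspace Z /\ forall f g h, Z (f, g) -> Z (f, h) -> g = h.

Definition closable (Z : set (X * X)) : Prop := linear_operator (closure Z).

End Operators.

Definition domain (E : Type) (Z : set (E * E)) : set E :=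
  [set f | exists g, Z (f, g)].


Section Dual.
Context (K : numFieldType) (X : tvsType K).

Definition continuous_functional : {pred X -> K^o} :=
  fun phi => `[< linear phi /\ continuous phi >].

Fact continuous_functional_submod : submod_closed continuous_functional.
Proof.
split=> [|a phi psi].
  apply/asboolP; split; last exact: cst_continuous.
  by move=> c x y /=; rewrite scaler0 addr0.
move=> /asboolP[lphi cphi] /asboolP[lpsi cpsi]; apply/asboolP; split.
  move=> c x y; have E u : (a *: phi + psi) u = a *: phi u + psi u by [].
  rewrite !E lphi lpsi !scalerDr !scalerA (mulrC a) -!addrA; congr (_ + _).
  by rewrite addrCA.
move=> x; apply: (@cvgD K K^o); last exact: cpsi.
by apply: (@cvgZr K K^o); exact: cphi.
Qed.

HB.instance Definition _ := GRing.isSubmodClosed.Build K (X -> K^o)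
  continuous_functional continuous_functional_submod.

Context (Omega : Type).

Record dual (p : Omega -> X -> K) :=
  Dual { dual_fun :> X -> K^o; _ : dual_fun \in continuous_functional }.

Variable p : Omega -> X -> K.

HB.instance Definition _ := [isSub for @dual_fun p].
HB.instance Definition _ := [Choice of dual p by <:].
HB.instance Definition _ := [SubChoice_isSubLmodule of dual p by <:].

(* The strong topology, with seminorms phi |-> sup_A |phi| for A bounded. *)
HB.instance Definition _ := Topological.copy (dual p)
  (initial_topology (fun phi : dual p =>
     (phi : X -> K^o) : {family seminorm_bounded p, X -> K^o})).

(* X with the topology sigma(X, X^* ). *)
Definition weakly : Type :=
  initial_topology (fun x : X => (fun phi : dual p => phi x) : {ptws dual p -> K^o}).
HB.instance Definition _ := Topological.on weakly.

Fact comp_continuous_functional (G : bounded_op X) (phi : dual p) :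
  phi \o G \in continuous_functional.
Proof.
case: phi => phi /= /asboolP[lphi cphi]; apply/asboolP; split.
  by move=> c x y /=; rewrite linearP lphi.
by move=> x; apply: continuous_comp; [exact: op_continuous|exact: cphi].
Qed.

Definition adjoint (G : bounded_op X) (phi : dual p) : dual p :=
  Dual p (comp_continuous_functional G phi).

(* Stated for a complete X, which is its own completion. *)
Definition star_dense (A : set (dual p)) : Prop :=
  forall phi : dual p, exists u : nat -> dual p,
    (forall k, A (u k)) /\
    forall x, (fun k => u k x) @ \oo --> phi x.

End Dual.

Section StrongDerivative.
Context (R : realType) (T : scalar_kind).
Local Notation K := (scalar_field R T).

Definition strong_derivative0 (E : preTopologicalLmodType K) (S : R -> E -> E)
    : set (E * E) :=
  [set z | (fun h : R => (of_real h)^-1 *: (S h z.1 - S 0 z.1)) @ 0^'+ --> z.2].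

Context (X : tvsType K).

Definition mef_derivative0 (F : R -> X -> X) (f : X) : set X :=
  [set g | exists2 f_ : R -> X, f_ @ 0^'+ --> f &
    (fun h : R => (of_real h)^-1 *: (F h (f_ h) - F 0 (f_ h))) @ 0^'+ --> g].

Definition mef_domain (F : R -> X -> X) : set X :=
  [set f | mef_derivative0 F f !=set0].

(* For F in F_X the set [mef_derivative0 F f] is a singleton when f is in
   [mef_domain F], so that no choice is involved there. *)
Definition ef_derivative0 (F : R -> X -> X) (f : X) : X :=
  xget 0 (mef_derivative0 F f).

End StrongDerivative.

(* A function on [0, oo) is represented by a function on R of which only the
   values at nonnegative arguments are used. *)
Section FunctionClasses.
Context (R : realType) (T : scalar_kind) (X : tvsType (scalar_field R T)).
Context (Omega : Type) (p : Omega -> X -> scalar_field R T).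
Implicit Type F : R -> bounded_op X.

Definition B_set F (s : R) : set (X -> X) :=
  [set G | exists (d : R) (n m : nat),
    [/\ 0 <= d, (0 < n)%N, (0 < m)%N, m%:R * d / n%:R <= s
      & G = iter m (F (d / n%:R))]].

Definition E_class F : Prop :=
  (forall x, F 0 x = x) /\
  forall s, 0 <= s -> equicontinuous_ops p (B_set F s).

Definition F_class F : Prop := E_class F /\ dense (mef_domain F).

Definition lC0_semigroup (S : R -> bounded_op X) : Prop :=
  [/\ {within [set s | 0 <= s], continuous S},
      forall x, S 0 x = x,
      forall l m, 0 <= l -> 0 <= m -> forall x, S (l + m) x = S l (S m x)
    & E_class S].

Definition generator (S : R -> bounded_op X) : set (X * X) :=
  strong_derivative0 S.

(* F(t/n)^[ns] f; the term n = 0, which does not occur in the sequences of the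
   theory, is f, since t / 0 = 0 and [0 s] = 0. *)
Definition chernoff_seq F (t s : R) (f : X) (n : nat) : X :=
  iter (Num.truncn (n%:R * s)) (F (t / n%:R)) f.

Definition weak_cvg (u : nat -> X) (l : X) : Prop :=
  (u : nat -> weakly p) @ \oo --> (l : weakly p).

Definition subsequence_index (sigma : nat -> nat) : Prop :=
  {homo sigma : i j / (i < j)%N}.

End FunctionClasses.

(* Main.v *)
From HB Require Import structures.
Require Import Defs.
From mathcomp Require Import all_boot all_order all_algebra.
From mathcomp Require Import all_classical all_reals all_analysis.
From mathcomp Require Import ring lra.

(* Write h = t/n, F_n = F(h), and let W be the relation of pairs (f, g) with
   F_n^k f - f - h (g + F_n g + ... + F_n^(k-1) g) -> 0 uniformly for k <= ns.
   W is closed, contains the effective derivative, and is single-valued when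
   densely defined, which makes Z closable. If a solution u of u' = t Zbar u on
   [0, s] is known at the points of a fine enough partition, telescoping F_n
   along that partition shows that F_n^[ns] u(0) - u(s) is small for n large.
   By (iii), (iv) and Hahn-Banach, weak limits along a subsequence provide such
   values of u for f in A; so F(t/n)^[ns] f is strongly Cauchy, its limit S(ts) f
   is a semigroup, and its generator is Zbar because, by (iv), the Riemann
   integrals of S(r) f (f in A) lie in the domain of Zbar.
   Conversely one takes F = S; the functionals a^-2 phi o I_a o I_a, with
   I_a = int_0^a S(r) dr, tend to phi, and integrating twice makes the
   difference quotients converge uniformly on bounded sets. *)

Set Implicit Arguments.
Unset Strict Implicit.
Unset Printing Implicit Defensive.

Import Order.TTheory GRing.Theory Num.Theory.
Import numFieldNormedType.Exports.

Local Open Scope classical_set_scope.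
Local Open Scope ring_scope.

(** Equicontinuity holds on bounded time intervals only, without an exponential bound, so a
    resolvent need not exist; every estimate therefore stays on a finite interval and passes from a
    seminorm [q] to a larger one. The obstacle is that v = Zbar u need not lie in a domain, so the
    speed at which F_n^j v leaves v is unknown at the points of the partition. For (f, g) in Z one
    picks (a, b) in Z with g - a small: F_n keeps g - a small and b bounded, and both bounds survive
    weak limits because seminorms are weakly lower semicontinuous. A block of duration tau then
    costs about tau (2 eta + tau B), where eta bounds the images of g - a and B those of b, and a
    path of total duration c costs about c (2 eta + tau B): a is chosen before the mesh. The
    subsequence only manufactures the finitely many values of u; the estimate built on them holds
    for all large n. The limit point depends on the seminorm and on the accuracy, which still makes
    the whole sequence Cauchy. *)

Section Scalars.
Context (R : realType) (T : scalar_kind).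
Local Notation K := (scalar_field R T).

(** Meant for nonnegative scalars, where it inverts [of_real]: with it all inequalities between
    seminorms are carried out in [R], for both scalar fields at once. *)
Definition real_part : K -> R :=
  match T return scalar_field R T -> R with
  | RealScalars => id
  | ComplexScalars => @complex.Re R
  end.

Fact of_real_zmod_morphism : zmod_morphism (@of_real R T).
Proof. by case: T => // x y; exact: rmorphB. Qed.
HB.instance Definition _ := GRing.isZmodMorphism.Build R K of_real
  of_real_zmod_morphism.

Fact of_real_monoid_morphism : monoid_morphism (@of_real R T).
Proof. by case: T; split => // x y; exact: rmorphM. Qed.
HB.instance Definition _ := GRing.isMonoidMorphism.Build R K of_real
  of_real_monoid_morphism.

Lemma of_realK (r : R) : real_part (of_real r) = r.
Proof. by rewrite /real_part; case: T. Qed.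

Lemma real_partK (z : K) : 0 <= z -> of_real (real_part z) = z.
Proof.
rewrite /real_part; move: z; case: T => //= -[a b].
by rewrite lecE /= => /andP[/eqP -> _].
Qed.

Lemma ler_of_real (a b : R) : (of_real a <= of_real b :> K) = (a <= b).
Proof. by rewrite /of_real; case: T => //; exact: lecR. Qed.

Lemma ltr_of_real (a b : R) : (of_real a < of_real b :> K) = (a < b).
Proof. by rewrite /of_real; case: T => //; exact: ltcR. Qed.

Lemma of_real_inj : injective (@of_real R T).
Proof. by move=> a b ab; rewrite -[a]of_realK ab of_realK. Qed.

Definition modulus (z : K) : R := real_part `|z|.

Lemma of_real_modulus z : of_real (modulus z) = `|z|.
Proof. exact: real_partK. Qed.

Lemma modulus_ge0 z : 0 <= modulus z.
Proof. by rewrite -ler_of_real of_real_modulus rmorph0. Qed.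

Lemma modulus_of_real (r : R) : modulus (of_real r) = `|r|.
Proof.
apply: of_real_inj; rewrite of_real_modulus.
case: (lerP 0 r) => [r0|/ltW r0].
  by rewrite (ger0_norm r0) ger0_norm // -(rmorph0 of_real) ler_of_real.
rewrite (ler0_norm r0) rmorphN ler0_norm //.
by rewrite -(rmorph0 of_real) ler_of_real.
Qed.

Lemma modulusM x y : modulus (x * y) = modulus x * modulus y.
Proof. by apply: of_real_inj; rewrite rmorphM /= !of_real_modulus normrM. Qed.

Lemma modulusN x : modulus (- x) = modulus x.
Proof. by rewrite /modulus normrN. Qed.

Lemma modulusD x y : modulus (x + y) <= modulus x + modulus y.
Proof. by rewrite -ler_of_real rmorphD /= !of_real_modulus ler_normD. Qed.

Lemma modulus0 : modulus 0 = 0.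
Proof. by rewrite -(rmorph0 of_real) modulus_of_real normr0. Qed.

Lemma modulus0_eq0 x : modulus x = 0 -> x = 0.
Proof.
by move=> x0; apply/eqP; rewrite -normr_eq0 -of_real_modulus x0 rmorph0.
Qed.

Lemma scalar_cvgP I (F : set_system I) {FF : Filter F} (f : I -> K^o) (l : K^o) :
  f @ F --> l <-> forall e : R, 0 < e -> \forall i \near F, modulus (f i - l) < e.
Proof.
split=> [/cvgrPdist_lt fl e e0|fl]; last first.
  apply/cvgrPdist_lt => e e0; have e0' : 0 < real_part e.
    by rewrite -ltr_of_real real_partK ?ltW // rmorph0.
  apply: filterS (fl _ e0') => i; rewrite -ltr_of_real of_real_modulus.
  by rewrite real_partK ?ltW // distrC.
have /fl : 0 < of_real e :> K by rewrite -(rmorph0 of_real) ltr_of_real.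
by apply: filterS => i; rewrite distrC -of_real_modulus ltr_of_real.
Qed.

End Scalars.

Section RealSeminorm.
Context (R : realType) (T : scalar_kind) (V : lmodType (scalar_field R T)).
Local Notation K := (scalar_field R T).

Definition real_seminorm (q : V -> R) : Prop :=
  (forall x y, q (x + y) <= q x + q y) /\
  forall (a : K) x, q (a *: x) = modulus a * q x.

Context (q : V -> R) (hq : real_seminorm q).

Lemma rsnD x y : q (x + y) <= q x + q y. Proof. exact: hq.1. Qed.

Lemma rsnZ (a : K) x : q (a *: x) = modulus a * q x. Proof. exact: hq.2. Qed.

Lemma rsnZr (r : R) x : q (of_real r *: x) = `|r| * q x.
Proof. by rewrite rsnZ modulus_of_real. Qed.

Lemma rsn0 : q 0 = 0.
Proof. by rewrite -(scale0r 0) rsnZ modulus0 mul0r. Qed.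

Lemma rsnN x : q (- x) = q x.
Proof.
rewrite -scaleN1r rsnZ modulusN -(rmorph1 of_real) modulus_of_real normr1.
exact: mul1r.
Qed.

Lemma rsnBC x y : q (x - y) = q (y - x).
Proof. by rewrite -opprB rsnN. Qed.

Lemma rsn_ge0 x : 0 <= q x.
Proof. by have := rsnD x (- x); rewrite subrr rsn0 rsnN; lra. Qed.

Lemma rsnB x y : q (x - y) <= q x + q y.
Proof. by rewrite -[q y]rsnN rsnD. Qed.

Lemma rsn_tri z x y : q (x - y) <= q (x - z) + q (z - y).
Proof. by apply: le_trans (rsnD _ _); rewrite addrA subrK. Qed.

Lemma rsn_sum n (F : nat -> V) :
  q (\sum_(i < n) F i) <= \sum_(i < n) q (F i).
Proof.
elim: n => [|n IH]; first by rewrite !big_ord0 rsn0.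
by rewrite !big_ord_recr /=; apply: le_trans (rsnD _ _) _; rewrite lerD2r.
Qed.

Lemma rsn_sum_le n (F : nat -> V) c : (forall i, (i < n)%N -> q (F i) <= c) ->
  q (\sum_(i < n) F i) <= n%:R * c.
Proof.
move=> Fc; apply: le_trans (rsn_sum _ _) _.
have -> : n%:R * c = \sum_(i < n) c by rewrite sumr_const card_ord mulr_natl.
by apply: ler_sum => i _; exact: Fc.
Qed.

End RealSeminorm.

(** * Continuous seminorms *)

Section BasicSeminorms.
Context (R : realType) (T : scalar_kind) (X : tvsType (scalar_field R T)).
Local Notation K := (scalar_field R T).
Context (Omega : Type) (p : Omega -> X -> K) (hp : generating_seminorms p).

Let pr a x : R := real_part (p a x).

(* Real-valued finite sums of the b * p a, with b >= 0. *)
Inductive basic_seminorm : (X -> R) -> Prop :=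
| basic_zero : basic_seminorm (fun=> 0)
| basic_add q a b : basic_seminorm q -> 0 <= b ->
    basic_seminorm (fun x => q x + b * real_part (p a x)).

Let prK a x : of_real (pr a x) = p a x.
Proof. by apply: real_partK; have [H _ _] := hp.1 a. Qed.

Let pr_seminorm a : real_seminorm (pr a).
Proof.
have [H0 HD HZ] := hp.1 a; split=> [x y|k x].
  by rewrite -(ler_of_real T) rmorphD /= !prK.
by apply: (@of_real_inj R T); rewrite rmorphM /= of_real_modulus !prK.
Qed.

Lemma basic_seminormP q : basic_seminorm q -> real_seminorm q.
Proof.
elim=> {q} [|q a b _ hq b0].
  by split=> [x y|k x]; rewrite ?addr0 ?mulr0.
have hr := pr_seminorm a; split=> [x y|k x].
  by have := rsnD hq x y; have := rsnD hr x y; rewrite /pr => *; nra.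
have := rsnZ hr k x; have := rsnZ hq k x; rewrite /pr => -> ->; ring.
Qed.

Lemma basic_single a : basic_seminorm (pr a).
Proof.
have -> : pr a = (fun x => 0 + 1 * pr a x) by apply/funext => x; ring.
by apply: basic_add => //; exact: basic_zero.
Qed.

Lemma basicD q r : basic_seminorm q -> basic_seminorm r ->
  basic_seminorm (fun x => q x + r x).
Proof.
move=> hq; elim=> {r} [|r a b _ IH b0].
  by have -> : (fun x => q x + 0) = q by apply/funext => x; rewrite addr0.
have -> : (fun x => q x + (r x + b * pr a x)) =
          (fun x => (q x + r x) + b * pr a x) by apply/funext => x; ring.
exact: basic_add.
Qed.

Lemma basicZ q c : basic_seminorm q -> 0 <= c ->
  basic_seminorm (fun x => c * q x).
Proof.
move=> + c0; elim=> {q} [|q a b _ IH b0].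
  have -> : (fun _ : X => c * 0) = (fun=> 0) by apply/funext => x; ring.
  exact: basic_zero.
have -> : (fun x => c * (q x + b * pr a x)) =
          (fun x => c * q x + (c * b) * pr a x) by apply/funext => x; ring.
by apply: basic_add => //; exact: mulr_ge0.
Qed.

Lemma basic_family n (al : 'I_n -> Omega) (b : 'I_n -> R) :
  (forall i, 0 <= b i) ->
  basic_seminorm (fun x => \sum_(i < n) b i * pr (al i) x).
Proof.
elim: n al b => [|n IH] al b b0.
  have -> : (fun x => \sum_(i < 0) b i * pr (al i) x) = (fun=> 0).
    by apply/funext => x; rewrite big_ord0.
  exact: basic_zero.
under eq_fun do rewrite big_ord_recr.
by apply: basic_add => //; apply: IH.
Qed.

(** Coefficients of a basic seminorm may vanish, while the definition of equicontinuity asks for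
    positive ones; raising [b] to [b + 1] repairs this at the price of an inequality. *)
Lemma basic_le_family q : basic_seminorm q ->
  exists n (al : 'I_n -> Omega) (b : 'I_n -> R), (forall i, 0 < b i) /\
    forall x, q x <= \sum_(i < n) b i * pr (al i) x.
Proof.
elim=> {q} [|q a b _ [n [al [c [c0 qc]]]] b0].
  exists 0%N, (fun i : 'I_0 => match notF (ltn_ord i) with end), (fun=> 1).
  by split=> // x; rewrite big_ord0.
exists n.+1, (fun i => oapp al a (unlift ord0 i)),
  (fun i => oapp c (b + 1) (unlift ord0 i)).
split=> [i|x]; first by case: unliftP => //= _; lra.
rewrite big_ord_recl unlift_none /= addrC lerD //; last first.
  by under eq_bigr do rewrite liftK /=.
by rewrite ler_wpM2r //; [exact: (rsn_ge0 (pr_seminorm a))|lra].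
Qed.

(** Stability under sums and nonnegative multiples absorbs finite intersections and radii, so unit
    balls of single basic seminorms form a base of neighbourhoods. *)
Lemma basic_nbhsP (x : X) (A : set X) : nbhs x A <->
  exists2 q, basic_seminorm q & forall y, q (y - x) < 1 -> A y.
Proof.
split=> [/nbhsP[U /hp.2[n [al [e [e0 Ue]]]] UA]|[q hq qA]].
  pose d := real_part e; have de : of_real d = e by apply: real_partK; exact: ltW.
  have d0 : 0 < d by rewrite -(ltr_of_real T) de rmorph0.
  exists (fun x => \sum_(i < n) d^-1 * pr (al i) x).
    by apply: basic_family => i; rewrite invr_ge0 ltW.
  move=> y yx; apply: UA; rewrite /xsection /= inE; apply: Ue => i.
  rewrite -prK -de ltr_of_real (rsnBC (pr_seminorm _)).
  rewrite -(mulr1 d) -ltr_pdivrMl //; apply: le_lt_trans yx.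
  rewrite (bigD1 i) //= lerDl sumr_ge0 // => j _.
  by apply: mulr_ge0; [rewrite invr_ge0 ltW|exact: (rsn_ge0 (pr_seminorm _))].
have [n [al [b [b0 qb]]]] := basic_le_family hq.
pose s := \sum_(i < n) b i.
have s0 : 0 <= s by apply: sumr_ge0 => i _; exact: ltW.
pose d := (s + 1)^-1.
have d0 : 0 < d by rewrite invr_gt0; lra.
apply/nbhsP; exists [set z | q (z.2 - z.1) < 1]; last first.
  by move=> y; rewrite /xsection /= inE; exact: qA.
apply/hp.2; exists n, al, (of_real d).
split=> [|x1 y1 H]; first by rewrite -(rmorph0 of_real) ltr_of_real.
rewrite /= (rsnBC (basic_seminormP hq)); apply: le_lt_trans (qb _) _.
apply: (@le_lt_trans _ _ (s * d)).
  rewrite /s mulr_suml; apply: ler_sum => i _; rewrite ler_wpM2l //; first exact: ltW.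
  by rewrite -(ler_of_real T) prK ltW.
by rewrite /d -ltr_pdivlMr ?invr_gt0 ?invrK; lra.
Qed.

Lemma basic_ball q (x : X) (e : R) : basic_seminorm q -> 0 < e ->
  nbhs x [set y | q (y - x) < e].
Proof.
move=> hq e0; apply/basic_nbhsP; exists (fun x => e^-1 * q x).
  by apply: basicZ => //; rewrite invr_ge0 ltW.
by move=> y; rewrite /= ltr_pdivrMl // mulr1.
Qed.

Lemma basic_cvgP I (F : set_system I) {FF : Filter F} (f : I -> X) (l : X) :
  f @ F --> l <-> forall q, basic_seminorm q -> forall e : R, 0 < e ->
    \forall i \near F, q (f i - l) < e.
Proof.
split=> [fl q hq e e0|fl A /basic_nbhsP[q hq qA]]; last first.
  by apply: filterS (fl q hq _ ltr01) => i; exact: qA.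
exact: fl _ (basic_ball l hq e0).
Qed.

Lemma basic_closureP (Z : set (X * X)) f g : closure Z (f, g) <->
  forall q, basic_seminorm q -> forall e : R, 0 < e ->
    exists f' g', [/\ Z (f', g'), q (f' - f) < e & q (g' - g) < e].
Proof.
split=> [H q hq e e0|H A [[A1 A2] /= [hA1 hA2] A12]].
  have N x := basic_ball x hq e0.
  have [] := H ([set y | q (y - f) < e] `*` [set y | q (y - g) < e]).
    by exists ([set y | q (y - f) < e], [set y | q (y - g) < e]).
  by move=> [f' g'] [Zfg [/= h1 h2]]; exists f', g'.
have [q1 hq1 q1A] := (basic_nbhsP f A1).1 hA1.
have [q2 hq2 q2A] := (basic_nbhsP g A2).1 hA2.
have [f' [g' [Zfg h1 h2]]] := H _ (basicD hq1 hq2) _ ltr01.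
exists (f', g'); split=> //; apply: A12; split=> /=.
  apply: q1A; apply: le_lt_trans h1; rewrite lerDl.
  exact: (rsn_ge0 (basic_seminormP hq2)).
apply: q2A; apply: le_lt_trans h2; rewrite lerDr.
exact: (rsn_ge0 (basic_seminormP hq1)).
Qed.

Lemma dense_basicP (A : set X) : dense A <->
  forall x q, basic_seminorm q -> forall e : R, 0 < e ->
    exists2 y, A y & q (y - x) < e.
Proof.
split=> [dA x q hq e e0|H O [x Ox] oO]; last first.
  have /basic_nbhsP[q hq qO] : nbhs x O by apply: open_nbhs_nbhs.
  by have [y Ay /qO] := H x q hq _ ltr01; exists y.
have N := basic_ball x hq e0.
have [y [/interior_subset yO Ay]] := dA _ (ex_intro _ x N) (open_interior _).
by exists y.
Qed.

Lemma basic_equicontinuousP (G : set (X -> X)) : equicontinuous_ops p G <->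
  forall q, basic_seminorm q -> exists2 r, basic_seminorm r &
    forall g, G g -> forall x, q (g x) <= r x.
Proof.
split=> [H q|H a].
  elim=> {q} [|q a b hq [r hr qr] b0].
    by exists (fun=> 0); first exact: basic_zero.
  have [n [al [c [c0 Hc]]]] := H a.
  pose s x := \sum_(i < n) real_part (c i) * pr (al i) x.
  have c0' i : 0 <= real_part (c i).
    by rewrite -(ler_of_real T) real_partK ?rmorph0 // ltW.
  exists (fun x => r x + b * s x).
    by apply: basicD => //; apply: basicZ => //; exact: basic_family.
  move=> g Gg x; rewrite lerD ?qr // ler_wpM2l //.
  rewrite -/(pr _ _) -(ler_of_real T) prK rmorph_sum /=.
  apply: le_trans (Hc g Gg x) _; apply: ler_sum => i _.
  by rewrite rmorphM /= prK real_partK // ltW.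
have [r /basic_le_family[n [al [b [b0 rb]]]] hr] := H _ (basic_single a).
exists n, al, (fun i => of_real (b i)); split=> [i|g Gg x].
  by rewrite -(rmorph0 of_real) ltr_of_real.
rewrite -prK.
have -> : \sum_(i < n) of_real (b i) * p (al i) x =
          of_real (\sum_(i < n) b i * pr (al i) x).
  by rewrite rmorph_sum; apply: eq_bigr => i _; rewrite rmorphM /= prK.
by rewrite ler_of_real; apply: le_trans (hr g Gg x) (rb x).
Qed.

Lemma basic_linear_continuous (G : {linear X -> X}) :
  (forall q, basic_seminorm q -> exists2 r, basic_seminorm r &
    forall x, q (G x) <= r x) -> continuous G.
Proof.
move=> H x; apply/basic_cvgP => q hq e e0; have [r hr qr] := H q hq.
have /basic_cvgP/(_ r hr e e0) : id @ x --> x by exact: cvg_id.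
by apply: filterS => y ye; rewrite -linearB; apply: le_lt_trans (qr _) ye.
Qed.

Lemma functional_continuous (phi : X -> K^o) : linear phi ->
  (exists2 q, basic_seminorm q & forall x, modulus (phi x) <= q x) ->
  continuous phi.
Proof.
move=> lphi [q hq phiq] x; apply/scalar_cvgP => e e0.
have /basic_cvgP/(_ q hq e e0) : id @ x --> x by exact: cvg_id.
apply: filterS => y ye; apply: le_lt_trans ye.
have -> : phi y - phi x = phi (y - x).
  by rewrite (addrC y) -(scaleN1r x) lphi addrC scaleN1r.
exact: phiq.
Qed.

Lemma functional_bounded (phi : dual p) :
  exists2 q, basic_seminorm q & forall x, modulus (phi x) <= q x.
Proof.
case: phi => phi /= /asboolP[lphi cphi].
have phi0 : phi 0 = 0.
  by have := lphi (-1) 0 0; rewrite scaler0 addr0 scaleN1r addNr.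
have phiZ (a : K) x : phi (a *: x) = a * phi x.
  by have := lphi a x 0; rewrite !addr0 phi0 addr0.
have /scalar_cvgP/(_ 1 ltr01) := cphi 0.
move=> /basic_nbhsP[q hq qphi]; exists q => // x.
have q0 := rsn_ge0 (basic_seminormP hq) x.
(* The vector is normalised by [q x + e], since [q x] may vanish. *)
apply/ler_addgt0Pr => e e0; have c0 : 0 < q x + e by lra.
have := qphi (of_real (q x + e)^-1 *: x).
rewrite subr0 (rsnZr (basic_seminormP hq)) phi0 subr0 phiZ modulusM modulus_of_real.
rewrite gtr0_norm ?invr_gt0 // !ltr_pdivrMl // mulr1 => /(_ _)/ltW; apply.
lra.
Qed.

Lemma hausdorff_basic_eq : hausdorff_space X -> forall x y : X,
  (forall q, basic_seminorm q -> forall e : R, 0 < e -> q (x - y) < e) -> x = y.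
Proof.
move=> hX x y H; apply: hX => A B /basic_nbhsP[q hq qA] /basic_nbhsP[r hr rB].
exists x; split; first by apply: qA; rewrite subrr (rsn0 (basic_seminormP hq)).
exact/rB/H.
Qed.

(** Two terms close to a common point are close to each other, so [l] may depend on [q] and [e].
    Compactness arguments supply the Cauchy property in just this form. *)
Lemma complete_seq_cvg : complete_space X -> forall u : nat -> X,
  (forall q, basic_seminorm q -> forall e : R, 0 < e ->
     exists l : X, \forall n \near \oo, q (u n - l) < e) ->
  exists x : X, u @ \oo --> x.
Proof.
move=> cX u H; apply: cX => U /hp.2[n [al [e [e0 Ue]]]].
pose d := real_part e; have de : of_real d = e by apply: real_partK; exact: ltW.
have d0 : 0 < d by rewrite -(ltr_of_real T) de rmorph0.
have hq : basic_seminorm (fun x => \sum_(i < n) 1 * pr (al i) x).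
  exact: basic_family.
have d2 : 0 < d / 2 by lra.
have [l hl] := H _ hq _ d2.
pose V := [set y : X | \sum_(i < n) 1 * pr (al i) (y - l) < d / 2].
exists (V, V); first by split; exact: hl.
move=> [x y] [/= Vx Vy]; apply: Ue => i.
rewrite -prK -de ltr_of_real.
have le1 z : pr (al i) z <= \sum_(i < n) 1 * pr (al i) z.
  rewrite (bigD1 i) //= mul1r lerDl sumr_ge0 // => j _.
  by rewrite mul1r; exact: (rsn_ge0 (pr_seminorm _)).
have := rsn_tri (pr_seminorm (al i)) l x y.
rewrite (rsnBC (pr_seminorm _) l y).
by have := le1 (x - l); have := le1 (y - l); move: Vx Vy; rewrite /V /=; lra.
Qed.

End BasicSeminorms.

(** * Hahn-Banach theorem and weak limits *)

Section HahnBanach.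
Context (R : realType) (T : scalar_kind) (V : lmodType (scalar_field R T)).
Local Notation K := (scalar_field R T).

(** Only positive real factors occur: V is treated as a real space, which lets both scalar fields
    share the minimality argument. *)
Definition sublinear (f : V -> R) : Prop :=
  (forall x y, f (x + y) <= f x + f y) /\
  forall (r : R) x, 0 < r -> f (of_real r *: x) = r * f x.

Lemma sublinear_opp_le f x : sublinear f -> - f (- x) <= f x.
Proof.
case=> fD fZ; have := fZ 2 0 (ltr0Sn _ 1); rewrite scaler0 => f0.
by have := fD x (- x); rewrite subrr; lra.
Qed.

(** The classical lowering of f along y: it lies below f (take t = 0), and its value at - y is at
    most - f y (take t = 1). *)
Definition translate_inf (f : V -> R) (y x : V) : R :=
  inf [set f (x + of_real t *: y) - t * f y | t in [set t : R | 0 <= t]].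

Section TranslateInf.
Context (f : V -> R) (hf : sublinear f) (y : V).

Let has_inf_translate x :
  has_inf [set f (x + of_real t *: y) - t * f y | t in [set t : R | 0 <= t]].
Proof.
split; first by exists (f (x + of_real 0 *: y) - 0 * f y), 0 => /=.
exists (- f (- x)) => _ [t /= t0 <-].
have [{}t0|t0'] := ltP 0 t; last first.
  have -> : t = 0 by lra.
  by rewrite rmorph0 scale0r addr0 mul0r subr0; exact: sublinear_opp_le.
have := hf.1 (x + of_real t *: y) (- x); rewrite (addrC x) addrK hf.2 //; lra.
Qed.

Lemma translate_inf_le t x : 0 <= t ->
  translate_inf f y x <= f (x + of_real t *: y) - t * f y.
Proof. by move=> t0; apply: (ge_inf (has_inf_translate x).2); exists t. Qed.

Lemma translate_inf_ge x c :
  (forall t, 0 <= t -> c <= f (x + of_real t *: y) - t * f y) ->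
  c <= translate_inf f y x.
Proof.
move=> H; apply: lb_le_inf; first exact: (has_inf_translate x).1.
by move=> _ [t t0 <-]; exact: H.
Qed.

Lemma translate_inf_sublinear : sublinear (translate_inf f y).
Proof.
split=> [x z|r x r0].
  rewrite -lerBlDl; apply: translate_inf_ge => s s0.
  rewrite lerBlDl -lerBlDr; apply: translate_inf_ge => t t0.
  rewrite lerBlDr; apply: le_trans (translate_inf_le _ (addr_ge0 t0 s0)) _.
  have := hf.1 (x + of_real t *: y) (z + of_real s *: y).
  rewrite addrACA -scalerDl -rmorphD /=; lra.
have E t : f (of_real r *: x + of_real t *: y) =
    r * f (x + of_real (r^-1 * t) *: y).
  rewrite -hf.2 // scalerDr scalerA -rmorphM /= mulrA mulfV ?mul1r //.
  by rewrite gt_eqF.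
apply/eqP; rewrite eq_le; apply/andP; split.
  rewrite -ler_pdivrMl //; apply: translate_inf_ge => t t0.
  rewrite ler_pdivrMl //.
  apply: le_trans (translate_inf_le _ (mulr_ge0 (ltW r0) t0)) _.
  rewrite E mulrA mulVf ?gt_eqF // mul1r; lra.
apply: translate_inf_ge => t t0.
rewrite E -ler_pdivlMl //.
have rt0 : 0 <= r^-1 * t by rewrite mulr_ge0 // invr_ge0 ltW.
apply: le_trans (translate_inf_le _ rt0) _.
by rewrite mulrBr mulrA mulVf ?gt_eqF // mul1r mulrA.
Qed.

End TranslateInf.

(* A minimal sublinear functional l is linear, because the infimum of
   l (x + t y) - t (l y) over t >= 0 is again sublinear in x. *)
Lemma sublinear_majorizes_linear (q : V -> R) : sublinear q ->
  exists l : V -> R, [/\ forall x y, l (x + y) = l x + l y,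
    forall r x, l (of_real r *: x) = r * l x & forall x, l x <= q x].
Proof.
move=> hq; pose S := {f : V -> R | sublinear f /\ forall x, f x <= q x}.
(* The order is reversed, so that a maximal element for Zorn is a minimal functional. *)
pose le_S (f g : S) := `[< forall x, sval g x <= sval f x >].
have [||A Atot|[l [hl lq]] lmin] :=
    @ZL_preorder S (exist _ q (conj hq (fun x => lexx (q x)))) le_S.
- by move=> f; apply/asboolP.
- move=> f g h /asboolP fg /asboolP gh; apply/asboolP => x.
  exact: le_trans (gh x) (fg x).
- have [[f0 Af0]|A0] := pselect (A !=set0); last first.
    exists (exist _ q (conj hq (fun x => lexx (q x)))) => f Af.
    by exfalso; apply: A0; exists f.
  pose B x := [set sval f x | f in A].
  have hB x : has_inf (B x).
    split; first by exists (sval f0 x), f0.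
    exists (- q (- x)) => _ [[f [hf fq]] /= _ <-].
    by apply: le_trans (sublinear_opp_le _ hf); rewrite lerN2.
  pose g x := inf (B x).
  have gle f x : A f -> g x <= sval f x.
    by move=> Af; apply: (ge_inf (hB x).2); exists f.
  have gge c x : (forall f, A f -> c <= sval f x) -> c <= g x.
    move=> H; apply: lb_le_inf; first exact: (hB x).1.
    by move=> _ [f Af <-]; exact: H.
  have hg : sublinear g.
    split=> [x y|r x r0].
      rewrite -lerBlDl; apply/gge => f2 Af2; rewrite lerBlDl -lerBlDr.
      apply/gge => f1 Af1; rewrite lerBlDr.
      (* Subadditivity of the infimum needs one member of the chain for both arguments; the smaller
         of [f1] and [f2] serves. *)
      have [/asboolP f12|/asboolP f21] := Atot _ _ Af1 Af2.
        apply: le_trans (gle _ _ Af2) _; apply: le_trans ((svalP f2).1.1 x y) _.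
        by rewrite lerD2r.
      apply: le_trans (gle _ _ Af1) _; apply: le_trans ((svalP f1).1.1 x y) _.
      by rewrite lerD2l.
    apply/eqP; rewrite eq_le; apply/andP; split.
      rewrite -ler_pdivrMl //; apply/gge => f Af.
      by rewrite ler_pdivrMl // -(svalP f).1.2 // gle.
    apply/gge => f Af; rewrite (svalP f).1.2 //.
    by rewrite ler_wpM2l ?(ltW r0) // gle.
  have gq x : g x <= q x by apply: le_trans (gle _ _ Af0) ((svalP f0).2 x).
  exists (exist _ g (conj hg gq)) => f Af; apply/asboolP => x /=; exact: gle.
have lD x y : l (x + y) = l x + l y.
  apply/eqP; rewrite eq_le hl.1 /= -lerBrDr.
  have ml z : translate_inf l y z <= l z.
    have := translate_inf_le hl y z (lexx 0).
    by rewrite rmorph0 scale0r addr0 mul0r subr0.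
  pose g : S := exist _ _ (conj (translate_inf_sublinear hl y)
    (fun z => le_trans (ml z) (lq z))).
  (* Minimality gives [l x <= translate_inf l y x], whose term at t = 1 is l (x + y) - l y: the
     missing half of additivity. *)
  have /lmin/asboolP/(_ x) /= : le_S (exist _ l (conj hl lq)) g by apply/asboolP.
  move/le_trans; apply; have := translate_inf_le hl y x ler01.
  by rewrite rmorph1 scale1r mul1r.
have l0 : l 0 = 0 by have := lD 0 0; rewrite addr0; lra.
have lN x : l (- x) = - l x by have := lD x (- x); rewrite subrr l0; lra.
exists l; split=> // r x.
have [r0|r0|<-] := ltrgtP 0 r; last by rewrite rmorph0 scale0r l0 mul0r.
  exact: hl.2.
rewrite -[r]opprK rmorphN scaleNr lN hl.2 ?oppr_gt0 //; lra.
Qed.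

(** Lowering q along w before choosing a linear functional below it gives l (- w) <= - q w, hence l
    w = q w. This takes the place of an extension from the line spanned by w. *)
Lemma hahn_banach_real (q : V -> R) (w : V) : real_seminorm q ->
  exists l : V -> R, [/\ forall x y, l (x + y) = l x + l y,
    forall r x, l (of_real r *: x) = r * l x, forall x, l x <= q x & l w = q w].
Proof.
move=> hq; have sq : sublinear q.
  split=> [|r x r0]; first exact: hq.1.
  by rewrite (rsnZr hq) gtr0_norm.
have [l [lD lZ lq]] := sublinear_majorizes_linear (translate_inf_sublinear sq w).
have lq' x : l x <= q x.
  apply: le_trans (lq x) _; have := translate_inf_le sq w x (lexx 0).
  by rewrite rmorph0 scale0r addr0 mul0r subr0.
exists l; split=> //; apply/eqP; rewrite eq_le lq' /=.
have := le_trans (lq (- w)) (translate_inf_le sq w (- w) ler01).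
rewrite rmorph1 scale1r addNr mul1r (rsn0 hq).
have := lZ (-1) w; rewrite rmorphN rmorph1 scaleN1r => ->; lra.
Qed.

End HahnBanach.

(** In the complex case the functional is rebuilt from its real part l as l x - i l (i x). *)
Lemma hahn_banach (R : realType) (T : scalar_kind)
    (V : lmodType (scalar_field R T)) (q : V -> R) (w : V) : real_seminorm q ->
  exists phi : V -> scalar_field R T,
    [/\ forall a x y, phi (a *: x + y) = a * phi x + phi y,
        forall x, modulus (phi x) <= q x & q w <= modulus (phi w)].
Proof.
move=> hq; have [l [lD lZ lq lw]] := hahn_banach_real w hq.
have lN x : l (- x) = - l x.
  by have := lZ (-1) x; rewrite rmorphN rmorph1 scaleN1r mulN1r.
case: T V q w hq l lD lZ lq lw lN => V q w hq l lD lZ lq lw lN.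
  exists l; split=> [a x y|x|]; first by rewrite lD -lZ.
    by rewrite /modulus /= ler_norml lq andbT -lerN2 opprK -lN -(rsnN hq) lq.
  by rewrite /modulus /= -lw ler_norm.
pose phi x : R[i] := Complex (l x) (- l ('i%C *: x)).
have phiD x y : phi (x + y) = phi x + phi y.
  by rewrite /phi scalerDr !lD opprD.
have phiZ (a : R[i]) x : phi (a *: x) = a * phi x.
  case: a => a b.
  have -> : Complex a b = real_complex R a + 'i%C * real_complex R b.
    apply/eqP; rewrite eq_complex /=.
    by rewrite !(mul0r, mul1r, mulr0, add0r, addr0, subr0, mulr1) !eqxx.
  have phir (r : R) z : phi (real_complex R r *: z) = real_complex R r * phi z.
    rewrite /phi scalerA mulrC -scalerA !lZ; apply/eqP.
    by rewrite eq_complex /= !(mul0r, addr0, subr0) mulrN !eqxx.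
  have phii z : phi ('i%C *: z) = 'i%C * phi z.
    rewrite /phi scalerA.
    have -> : 'i%C * 'i%C = -1 :> R[i] by rewrite -expr2 sqr_i.
    rewrite scaleN1r lN opprK; apply/eqP.
    by rewrite eq_complex /= !(mul0r, mul1r, addr0, add0r, subr0, sub0r) opprK !eqxx.
  by rewrite scalerDl phiD -scalerA phii !phir mulrA mulrDl.
exists phi; split=> [a x y|x|]; first by rewrite phiD phiZ.
  have [->|x0] := eqVneq (phi x) 0.
    by rewrite modulus0; exact: (rsn_ge0 hq).
  (* The unimodular factor [u] rotates phi x onto the positive axis, so that |phi x| = l (u x) <= q
     (u x) = q x. *)
  pose u : R[i] := `|phi x| / phi x.
  have u1 : modulus (u : scalar_field R ComplexScalars) = 1.
    by rewrite /modulus normf_div normr_id divff ?normr_eq0.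
  have : l (u *: x) = modulus (phi x : scalar_field R ComplexScalars).
    have : phi (u *: x) = `|phi x| by rewrite phiZ /u divfK.
    by move=> /(congr1 (@complex.Re R)).
  by move=> <-; apply: le_trans (lq _) _; rewrite (rsnZ hq) u1 mul1r.
rewrite -lw; apply: le_trans (ler_norm _) _.
rewrite -(ler_of_real ComplexScalars) of_real_modulus.
by have := normc_ge_Re (phi w); rewrite /phi /=.
Qed.

Lemma cvg_initialP I (F : set_system I) {FF : Filter F} (S : choiceType)
    (U : topologicalType) (f : S -> U) (u : I -> S) (s : S) :
  (u : I -> initial_topology f) @ F --> (s : initial_topology f) <->
  (fun i => f (u i)) @ F --> f s.
Proof.
split=> [us|fus A /= [_ [[B oB <-] Bs sBA]]].
  exact: continuous_cvg (@initial_continuous _ _ f s) us.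
have H : F ((f \o u) @^-1` B) := fus B (open_nbhs_nbhs (conj oB Bs)).
by apply: (filterS _ H) => i; exact: sBA.
Qed.

Lemma cvg_ptwsP I (F : set_system I) {FF : Filter F} (S : Type)
    (U : topologicalType) (u : I -> S -> U) (f : S -> U) :
  (u : I -> {ptws S -> U}) @ F --> (f : {ptws S -> U}) <->
  forall x, (fun i => u i x) @ F --> f x.
Proof.
split=> [/cvg_sup uf x|uf]; first by have /cvg_initialP := uf x.
by apply/cvg_sup => x; apply/cvg_initialP; exact: uf.
Qed.

Lemma cvg_bounded_opP (K : numFieldType) (X : tvsType K) I (F : set_system I)
    {FF : Filter F} (S : I -> bounded_op X) (S0 : bounded_op X) :
  S @ F --> S0 <-> forall x, (fun i => S i x) @ F --> S0 x.
Proof.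
split=> [/cvg_initialP/cvg_ptwsP//|H].
by apply/cvg_initialP/cvg_ptwsP.
Qed.

Lemma leq_subseq_index sigma n : subsequence_index sigma -> (n <= sigma n)%N.
Proof.
by move=> hs; elim: n => // n IH; exact: leq_ltn_trans IH (hs _ _ (ltnSn n)).
Qed.

Lemma cvg_subseq_index sigma : subsequence_index sigma -> sigma @ \oo --> \oo.
Proof.
move=> hs A [N _ NA]; exists N => // n /= Nn; apply: NA => /=.
exact: leq_trans Nn (leq_subseq_index n hs).
Qed.

Section Duality.
Context (R : realType) (T : scalar_kind) (X : tvsType (scalar_field R T)).
Local Notation K := (scalar_field R T).
Context (Omega : Type) (p : Omega -> X -> K) (hp : generating_seminorms p).

Lemma weak_cvgP (u : nat -> X) l : weak_cvg p u l <->
  forall phi : dual p, (fun n => phi (u n)) @ \oo --> phi l.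
Proof.
split=> [/cvg_initialP/cvg_ptwsP//|H].
by apply/cvg_initialP/cvg_ptwsP.
Qed.

Lemma cvg_dual I (F : set_system I) {FF : Filter F} (u : I -> dual p)
    (phi : dual p) :
  (forall A, seminorm_bounded p A -> forall e : R, 0 < e ->
     \forall i \near F, forall x, A x -> modulus (u i x - phi x) < e) ->
  u @ F --> phi.
Proof.
move=> H; apply/cvg_initialP/fam_cvgP => A bA B /uniform_nbhs[E [entE EB]].
have [e e0 eE] : exists2 e : K, 0 < e & [set z | ball z.1 e z.2] `<=` E.
  by move: entE; rewrite -entourage_ballE => -[e e0 ?]; exists e.
have e0' : 0 < real_part e.
  by rewrite -(ltr_of_real T) real_partK ?ltW // rmorph0.
rewrite nbhs_filterE; apply: filterS (H A bA _ e0') => i Hi; apply: EB => x Ax.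
apply: eE; rewrite /= -ball_normE /= distrC -of_real_modulus.
by rewrite -[e]real_partK ?ltW // ltr_of_real; exact: Hi.
Qed.

Lemma dualP (phi : dual p) : linear phi /\ continuous phi.
Proof. by case: phi => phi /= /asboolP. Qed.

Lemma dualD (phi : dual p) x y : phi (x + y) = phi x + phi y.
Proof. by have := (dualP phi).1 1 x y; rewrite !scale1r. Qed.

Lemma dual0 (phi : dual p) : phi 0 = 0.
Proof. by have := (dualP phi).1 (-1) 0 0; rewrite scaler0 addr0 scaleN1r addNr. Qed.

Lemma dualZ (phi : dual p) (a : K) x : phi (a *: x) = a * phi x.
Proof. by have := (dualP phi).1 a x 0; rewrite !addr0 dual0 addr0. Qed.

Lemma dualB (phi : dual p) x y : phi (x - y) = phi x - phi y.
Proof. by rewrite dualD -scaleN1r dualZ mulN1r. Qed.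

Lemma cvg_weak_cvg (u : nat -> X) l : u @ \oo --> l -> weak_cvg p u l.
Proof.
move=> ul; apply/weak_cvgP => phi.
exact: continuous_cvg ((dualP phi).2 l) ul.
Qed.

Lemma weak_cvgD (u v : nat -> X) l m : weak_cvg p u l -> weak_cvg p v m ->
  weak_cvg p (fun n => u n + v n) (l + m).
Proof.
move=> /weak_cvgP ul /weak_cvgP vm; apply/weak_cvgP => phi.
rewrite dualD; under eq_fun do rewrite dualD.
by apply: (@cvgD K K^o); [exact: ul|exact: vm].
Qed.

Lemma weak_cvgZ (u : nat -> X) l (a : K) : weak_cvg p u l ->
  weak_cvg p (fun n => a *: u n) (a *: l).
Proof.
move=> /weak_cvgP ul; apply/weak_cvgP => phi.
rewrite dualZ; under eq_fun do rewrite dualZ.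
by apply: (@cvgZr K K^o); exact: ul.
Qed.

Lemma weak_cvgB (u v : nat -> X) l m : weak_cvg p u l -> weak_cvg p v m ->
  weak_cvg p (fun n => u n - v n) (l - m).
Proof.
move=> ul vm; have := weak_cvgD ul (weak_cvgZ (a := -1) vm).
by rewrite scaleN1r; under eq_fun do rewrite scaleN1r.
Qed.

Lemma weak_cvg_subseq (u : nat -> X) l sigma : subsequence_index sigma ->
  weak_cvg p u l -> weak_cvg p (u \o sigma) l.
Proof. by move=> /cvg_subseq_index; exact: cvg_comp. Qed.

Lemma functional_dual (phi : X -> K^o) : linear phi ->
  (exists2 q, basic_seminorm p q & forall x, modulus (phi x) <= q x) ->
  phi \in @continuous_functional K X.
Proof.
move=> lphi H; apply/asboolP; split=> //.
exact: (functional_continuous hp lphi H).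
Qed.

(** Weak lower semicontinuity of seminorms: a functional dominated by q that attains q l at l
    carries the bound to the limit. All quantitative information on weak limits is obtained this
    way. *)
Lemma weak_cvg_seminorm_le q (u : nat -> X) l (c : R) :
  basic_seminorm p q -> weak_cvg p u l -> (\forall n \near \oo, q (u n) <= c) ->
  q l <= c.
Proof.
move=> hq /weak_cvgP ul uc.
have [phi [lphi phiq phil]] := hahn_banach l (basic_seminormP hp hq).
have hphi : (phi : X -> K^o) \in @continuous_functional K X.
  by apply: functional_dual => //; exists q.
apply: le_trans phil _; apply/ler_addgt0Pr => e e0.
have /scalar_cvgP/(_ e e0) := ul (Dual p hphi).
rewrite /= => phiu; near \oo => n.
have h1 : modulus (phi (u n) - phi l) < e by near: n.
have h2 : q (u n) <= c by near: n.
have := modulusD (phi (u n)) (- (phi (u n) - phi l)).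
rewrite modulusN opprB addrCA subrr addr0.
have := phiq (u n); lra.
Unshelve. all: by end_near. Qed.

(* The distance to Z in the seminorm q(x) + q(y) is a seminorm on the product;
   a functional attaining it at the limit and dominated by it vanishes on Z. *)
Lemma weak_closure (Z : set (X * X)) (f g : nat -> X) u v : is_subspace Z ->
  (forall n, closure Z (f n, g n)) -> weak_cvg p f u -> weak_cvg p g v ->
  closure Z (u, v).
Proof.
move=> [Z0 ZD] Zfg /weak_cvgP fu /weak_cvgP gv; apply/(basic_closureP hp) => q hq e e0.
have sq := basic_seminormP hp hq.
pose D (w : X * X) := [set q (w.1 - z.1) + q (w.2 - z.2) | z in Z].
pose d (w : X * X) := inf (D w).
have D0 w z : 0 <= q (w.1 - z.1) + q (w.2 - z.2).
  by rewrite addr_ge0 //; exact: (rsn_ge0 sq).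
have hD w : has_inf (D w).
  split; first by exists (q (w.1 - 0) + q (w.2 - 0)), 0.
  by exists 0 => _ [z _ <-].
have d_le w z : Z z -> d w <= q (w.1 - z.1) + q (w.2 - z.2).
  by move=> Zz; apply: (ge_inf (hD w).2); exists z.
have d_ge w c : (forall z, Z z -> c <= q (w.1 - z.1) + q (w.2 - z.2)) -> c <= d w.
  move=> H; apply: lb_le_inf; first exact: (hD w).1.
  by move=> _ [z Zz <-]; exact: H.
have ZZ a z : Z z -> Z (a *: z) by move=> Zz; rewrite -[_ *: _]addr0; exact: ZD.
have dZle a w : d (a *: w) <= modulus a * d w.
  have [->|a0] := eqVneq a 0.
    rewrite modulus0 mul0r scale0r.
    by apply: le_trans (d_le 0 0 Z0) _; rewrite subr0 (rsn0 sq) addr0.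
  have ma : 0 < modulus a.
    rewrite lt_neqAle modulus_ge0 andbT eq_sym.
    by apply: contra_neq a0; exact: modulus0_eq0.
  rewrite -ler_pdivrMl //; apply/d_ge => z Zz; rewrite ler_pdivrMl //.
  apply: le_trans (d_le _ _ (ZZ a z Zz)) _.
  by rewrite /= -!scalerBr !(rsnZ sq) mulrDr.
have sd : real_seminorm d.
  split=> [w w'|a w].
    rewrite -lerBlDl; apply/d_ge => z Zz; rewrite lerBlDl -lerBlDr.
    apply/d_ge => z' Zz'; rewrite lerBlDr.
    have Zs : Z (1 *: z + z') by exact: ZD.
    apply: le_trans (d_le _ _ Zs) _; rewrite scale1r /=.
    have E (x x' y y' : X) : x + x' - (y + y') = (x - y') + (x' - y).
      by rewrite (addrC y) opprD addrACA.
    rewrite !E; have := rsnD sq (w.1 - z'.1) (w'.1 - z.1).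
    by have := rsnD sq (w.2 - z'.2) (w'.2 - z.2); lra.
  apply/eqP; rewrite eq_le dZle /=; have [->|a0] := eqVneq a 0.
    rewrite modulus0 mul0r; apply/d_ge => z _; exact: D0.
  have := dZle a^-1 (a *: w); rewrite scalerA mulVf // scale1r => H.
  have E : modulus a * modulus a^-1 = 1.
    by rewrite -modulusM mulfV // -(rmorph1 of_real) modulus_of_real normr1.
  have := ler_wpM2l (modulus_ge0 a) H; rewrite mulrA E mul1r; exact.
have [Phi [lPhi Phid Phiuv]] := hahn_banach (u, v) sd.
have PhiD x y : Phi (x + y) = Phi x + Phi y.
  by have := lPhi 1 x y; rewrite scale1r mul1r.
have Phi0 : Phi 0 = 0.
  by have := lPhi (-1) 0 0; rewrite scaler0 addr0 mulN1r addNr.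
(* Weak convergence is known in each factor only, so the functional on the product is split into two
   continuous functionals on X. *)
have hphi1 : (fun x : X => Phi (x, 0) : K^o) \in @continuous_functional K X.
  apply: functional_dual => [a x y|].
    apply: etrans (lPhi a (x, 0) (y, 0)); congr Phi; congr (_, _).
    by rewrite /= scaler0 addr0.
  exists q => // x; apply: le_trans (Phid _) _.
  by apply: le_trans (d_le (x, 0) 0 Z0) _; rewrite /= !subr0 (rsn0 sq) addr0.
have hphi2 : (fun y : X => Phi (0, y) : K^o) \in @continuous_functional K X.
  apply: functional_dual => [a x y|].
    apply: etrans (lPhi a (0, x) (0, y)); congr Phi; congr (_, _).
    by rewrite /= scaler0 addr0.
  exists q => // x; apply: le_trans (Phid _) _.
  by apply: le_trans (d_le (0, x) 0 Z0) _; rewrite /= !subr0 (rsn0 sq) add0r.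
have E x y : Phi (x, y) = Dual p hphi1 x + Dual p hphi2 y.
  by rewrite /= -PhiD; congr Phi; congr (_, _); rewrite /= ?addr0 ?add0r.
have Phifg n : Phi (f n, g n) = 0.
  apply: modulus0_eq0; apply/eqP; rewrite eq_le modulus_ge0 andbT.
  apply: le_trans (Phid _) _; apply/ler_addgt0Pr => c c0; rewrite add0r.
  have c2 : 0 < c / 2 by lra.
  have [f' [g' [Zf h1 h2]]] := (basic_closureP hp Z _ _).1 (Zfg n) q hq _ c2.
  apply: le_trans (d_le _ _ Zf) _; rewrite /= (rsnBC sq) (rsnBC sq (g n)); lra.
have duv0 : d (u, v) <= 0.
  apply: le_trans Phiuv _; suff -> : Phi (u, v) = 0 by rewrite modulus0.
  have cE : (fun n => Phi (f n, g n) : K^o) @ \oo --> (Phi (u, v) : K^o).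
    rewrite E; under eq_fun do rewrite E.
    by apply: (@cvgD K K^o); [exact: fu|exact: gv].
  have c0 : (fun n => Phi (f n, g n) : K^o) @ \oo --> (0 : K^o).
    by under eq_fun do rewrite Phifg; exact: cvg_cst.
  exact: (@cvg_unique K^o (@norm_hausdorff _ _) _ _ (Phi (u, v)) 0 cE c0).
have [_ [[f' g'] Zf <-] dlt] := inf_adherent e0 (hD (u, v)).
exists f', g'; move: dlt; rewrite -/(d (u, v)) /= (rsnBC sq) (rsnBC sq v) => dlt.
have := rsn_ge0 sq (f' - u); have := rsn_ge0 sq (g' - v).
by split=> //; lra.
Qed.

Lemma closure_subspace (Z : set (X * X)) : is_subspace Z -> is_subspace (closure Z).
Proof.
move=> [Z0 ZD]; split; first exact: subset_closure.
move=> a [f g] [f' g'] /(basic_closureP hp) H /(basic_closureP hp) H'.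
apply/(basic_closureP hp) => q hq e e0; have sq := basic_seminormP hp hq.
have m0 := modulus_ge0 a; pose c := e / (modulus a + 1).
have c0 : 0 < c by rewrite divr_gt0 //; lra.
have ce : (modulus a + 1) * c = e by rewrite /c mulrC divfK //; lra.
have [x [y [Zxy x1 y1]]] := H q hq c c0.
have [x' [y' [Zxy' x2 y2]]] := H' q hq c c0.
exists (a *: x + x'), (a *: y + y'); split; first exact: ZD _ _ _ Zxy Zxy'.
  rewrite opprD addrACA -scalerBr; have := rsnD sq (a *: (x - f)) (x' - f').
  rewrite (rsnZ sq); nra.
rewrite opprD addrACA -scalerBr; have := rsnD sq (a *: (y - g)) (y' - g').
rewrite (rsnZ sq); nra.
Qed.

End Duality.

(** * Chernoff approximation *)

Section IterateLinear.
Context (K : numFieldType) (X : lmodType K) (G : {linear X -> X}).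

Lemma iter_linearP k a x y : iter k G (a *: x + y) = a *: iter k G x + iter k G y.
Proof. by elim: k => //= k ->; rewrite linearP. Qed.

Lemma iter_linear0 k : iter k G 0 = 0.
Proof. by elim: k => //= k ->; rewrite linear0. Qed.

Lemma iter_linearD k x y : iter k G (x + y) = iter k G x + iter k G y.
Proof. by have := iter_linearP k 1 x y; rewrite !scale1r. Qed.

Lemma iter_linearZ k a x : iter k G (a *: x) = a *: iter k G x.
Proof. by have := iter_linearP k a x 0; rewrite iter_linear0 !addr0. Qed.

Lemma iter_linearB k x y : iter k G (x - y) = iter k G x - iter k G y.
Proof. by rewrite iter_linearD -scaleN1r iter_linearZ scaleN1r. Qed.

End IterateLinear.

Section FloorSteps.
Context (R : realType).

(** After [nr] steps of length t/n the elapsed time falls short of tr by at most one step. *)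
Lemma truncn_step_cvg (t r : R) : 0 <= t -> 0 <= r -> forall e, 0 < e ->
  \forall n \near \oo, t * r - e <= (Num.truncn (n%:R * r))%:R * (t / n%:R) <= t * r.
Proof.
move=> t0 r0 e e0; near=> n.
have n0 : 0 < n%:R :> R by rewrite ltr0n; near: n; exact: nbhs_infty_gt.
have tn : t / e <= n%:R by near: n; exact: nbhs_infty_ger.
have := truncn_itv (mulr_ge0 (ltW n0) r0).
set m := (Num.truncn _); rewrite -natr1 => /andP[h1 h2].
have hn : n%:R * (t / n%:R) = t by rewrite mulrC divfK // gt_eqF.
have h0 : 0 <= t / n%:R by rewrite divr_ge0 // ltW.
have he : t / n%:R <= e.
  by move: tn; rewrite ler_pdivrMr // ler_pdivrMr // mulrC.
apply/andP; split; last first.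
  by apply: le_trans (ler_wpM2r h0 h1) _; rewrite mulrAC hn.
have := ler_wpM2r h0 (ltW h2); rewrite mulrAC hn; lra.
Unshelve. all: by end_near. Qed.

Lemma truncn_sub_step_cvg (t r r' : R) : 0 <= t -> 0 <= r -> r <= r' ->
  forall e, 0 < e -> \forall n \near \oo,
    `|(Num.truncn (n%:R * r') - Num.truncn (n%:R * r))%N%:R * (t / n%:R)
       - t * (r' - r)| <= e.
Proof.
move=> t0 r0 rr' e e0.
have H := truncn_step_cvg t0 r0 e0.
have H' := truncn_step_cvg t0 (le_trans r0 rr') e0.
near=> n.
have /andP[h1 h2] : t * r - e <= (Num.truncn (n%:R * r))%:R * (t / n%:R) <= t * r.
  by near: n.
have /andP[h3 h4] :
    t * r' - e <= (Num.truncn (n%:R * r'))%:R * (t / n%:R) <= t * r' by near: n.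
rewrite natrB ?le_truncn ?ler_wpM2l // ler_norml; apply/andP; split; lra.
Unshelve. all: by end_near. Qed.

Lemma divn_cvg_right (t : R) : 0 < t -> (fun n => t / n%:R) @ \oo --> 0^'+.
Proof.
move=> t0 A; rewrite /at_right /within /= => /nbhs_ballP[e /= e0 eA].
suff H : \forall n \near \oo, A (t / n%:R) by exact: H.
near=> n.
have n0 : 0 < n%:R :> R by rewrite ltr0n; near: n; exact: nbhs_infty_gt.
have tn : t / e < n%:R by near: n; exact: nbhs_infty_gtr.
have h0 : 0 < t / n%:R by rewrite divr_gt0.
apply: eA => //; rewrite /ball /= sub0r normrN gtr0_norm //.
by move: tn; rewrite ltr_pdivrMr // ltr_pdivrMr // mulrC.
Unshelve. all: by end_near. Qed.

End FloorSteps.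

Section Chernoff.
Context (R : realType) (T : scalar_kind) (X : tvsType (scalar_field R T)).
Local Notation K := (scalar_field R T).
Context (Omega : Type) (p : Omega -> X -> K) (hp : generating_seminorms p).
Context (F : R -> bounded_op X) (t : R) (t_gt0 : 0 < t) (EF : E_class p F).

Local Notation step n := (t / n%:R).
Local Notation Q n k := (iter k (F (t / n%:R))).

(** Powers F(t/n)^k with 0 < k <= ns lie in [B_set F (t * s)] (take d = t). The summand q x in the
    bound takes care of k = 0, which [B_set] leaves out. *)
Lemma chernoff_bound q (s : R) : basic_seminorm p q -> 0 <= s ->
  exists2 r, basic_seminorm p r & (forall x, q x <= r x) /\
    forall n k x, (0 < n)%N -> k%:R <= n%:R * s -> q (Q n k x) <= r x.
Proof.
move=> hq s0; have ts0 : 0 <= t * s by rewrite mulr_ge0 // ltW.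
have [r hr Hr] := (basic_equicontinuousP hp _).1 (EF.2 _ ts0) q hq.
exists (fun x => q x + r x); first exact: basicD.
have q0 := rsn_ge0 (basic_seminormP hp hq).
have r0 := rsn_ge0 (basic_seminormP hp hr).
split=> [x|n k x n0 kn]; first by have := r0 x; lra.
have [k0|k0] := posnP k; first by rewrite k0 /=; have := r0 x; lra.
have := Hr (Q n k) _ x; have := q0 x => ? /(_ _)/le_trans; apply; last lra.
exists t, n, k; split=> //; first exact: ltW.
by rewrite ler_pdivrMr ?ltr0n //; have := t_gt0; nra.
Qed.

(** Discrete counterpart of S(hk) f - f - int_0^(hk) S(r) g dr with h = t/n, which vanishes when g
    is the value of the generator at f. *)
Definition chernoff_defect n k (f g : X) : X :=
  Q n k f - f - of_real (step n) *: \sum_(j < k) Q n j g.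

(** Uniformity in k is asked for because later k is a difference of two integer parts and varies
    with n. *)
Definition chernoff_graph : set (X * X) :=
  [set z | forall q, basic_seminorm p q -> forall s : R, 0 <= s ->
     forall e : R, 0 < e -> \forall n \near \oo,
       forall k, k%:R <= n%:R * s -> q (chernoff_defect n k z.1 z.2) <= e].

Lemma chernoff_defectB n k f g f' g' :
  chernoff_defect n k (f - f') (g - g') =
  chernoff_defect n k f g - chernoff_defect n k f' g'.
Proof.
rewrite /chernoff_defect iter_linearB.
under eq_bigr do rewrite iter_linearB.
rewrite sumrB scalerBr.
set a := Q n k f; set b := Q n k f'; set c := _ *: _; set d := _ *: _.
by rewrite !opprD !opprK [RHS]addrACA [X in _ = X + _]addrACA.
Qed.

Lemma step_le n k (s : R) : (0 < n)%N -> k%:R <= n%:R * s -> k%:R * step n <= t * s.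
Proof.
move=> n0 kn; rewrite mulrA ler_pdivrMr ?ltr0n //; have := t_gt0; nra.
Qed.

Lemma step_ge0 n : 0 <= step n.
Proof. by rewrite divr_ge0 // ltW. Qed.

Lemma chernoff_defect_le q r (s : R) : basic_seminorm p q -> (forall x, q x <= r x) ->
  (forall n k x, (0 < n)%N -> k%:R <= n%:R * s -> q (Q n k x) <= r x) ->
  forall n k f g, (0 < n)%N -> k%:R <= n%:R * s ->
    q (chernoff_defect n k f g) <= 2 * r f + k%:R * step n * r g.
Proof.
move=> hq qr Hr n k f g n0 kn; have sq := basic_seminormP hp hq.
have h0 := step_ge0 n.
apply: le_trans (rsnB sq _ _) _; rewrite (rsnZr sq) ger0_norm //.
have h1 := rsnB sq (Q n k f) f; have h2 := Hr n k f n0 kn; have h3 := qr f.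
have h4 : q (\sum_(j < k) Q n j g) <= k%:R * r g.
  apply: (rsn_sum_le sq) => j jk; apply: Hr => //; apply: le_trans kn.
  by rewrite ler_nat ltnW.
nra.
Qed.

(** If fn = f_h and gn is its difference quotient at h = t/n, then F_n fn = fn + h gn telescopes and
    (fn, gn) has defect exactly 0. The defect of (f, g) is thus that of the small pair (f - fn, g -
    gn). *)
Lemma chernoff_graph_mef f g : mef_derivative0 (fun s => F s : X -> X) f g ->
  chernoff_graph (f, g).
Proof.
case=> f_ /(cvg_comp _ _ (divn_cvg_right t_gt0)) ff
  /(cvg_comp _ _ (divn_cvg_right t_gt0)) fg q hq s s0 e e0.
have [r hr [qr Hr]] := chernoff_bound hq s0.
have sr := basic_seminormP hp hr; have sq := basic_seminormP hp hq.
have ts0 : 0 <= t * s by rewrite mulr_ge0 // ltW.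
(* By [chernoff_defect_le] a pair of size d in the seminorm r has defect at most (2 + ts) d. *)
pose d := e / (2 + t * s); have d0 : 0 < d by rewrite divr_gt0 //; lra.
have de : 2 * d + t * s * d = e by rewrite -mulrDl /d mulrC divfK //; lra.
have {}ff : \forall n \near \oo, r (f_ (t / n%:R) - f) < d.
  exact: (basic_cvgP hp _ _).1 ff r hr d d0.
have {}fg : \forall n \near \oo, r ((of_real (step n))^-1 *:
    (F (step n) (f_ (step n)) - F 0 (f_ (step n))) - g) < d.
  exact: (basic_cvgP hp _ _).1 fg r hr d d0.
near=> n => k kn /=.
have n0 : (0 < n)%N by near: n; exact: nbhs_infty_gt.
have h1 : r (f_ (step n) - f) < d by near: n.
have h2 : r ((of_real (step n))^-1 *:
    (F (step n) (f_ (step n)) - F 0 (f_ (step n))) - g) < d by near: n.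
set fn := f_ (step n) in h1 h2 *.
pose gn := (of_real (step n))^-1 *: (F (step n) fn - F 0 fn).
have E : chernoff_defect n k fn gn = 0.
  have step0 : of_real (step n) != 0 :> K.
    rewrite -(rmorph0 (of_real : R -> K)) (inj_eq (@of_real_inj R T)).
    by rewrite mulf_neq0 ?invr_eq0 ?pnatr_eq0 ?gt_eqF.
  have Fn : F (step n) fn = fn + of_real (step n) *: gn.
    by rewrite scalerA mulfV // scale1r (EF.1) addrC subrK.
  rewrite /chernoff_defect; apply/eqP; rewrite subr_eq0 subr_eq; apply/eqP.
  elim: (k) => [|m IH]; first by rewrite big_ord0 scaler0 add0r.
  rewrite iterSr Fn iter_linearD iter_linearZ IH big_ord_recr /= scalerDr.
  by rewrite addrAC.
rewrite -[chernoff_defect _ _ _ _]subr0 -E -chernoff_defectB.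
apply: le_trans (chernoff_defect_le hq qr Hr _ _ n0 kn) _.
rewrite (rsnBC sr) in h1; rewrite (rsnBC sr) -/gn in h2.
have h3 := step_le n0 kn; have h4 := rsn_ge0 sr (g - gn).
have h5 : 0 <= k%:R * step n by rewrite mulr_ge0 // step_ge0.
nra.
Unshelve. all: by end_near. Qed.

Lemma chernoff_graph_closed : closure chernoff_graph `<=` chernoff_graph.
Proof.
move=> [f g] /(basic_closureP hp) H q hq s s0 e e0 /=.
have [r hr [qr Hr]] := chernoff_bound hq s0.
have sr := basic_seminormP hp hr; have sq := basic_seminormP hp hq.
have ts0 : 0 <= t * s by rewrite mulr_ge0 // ltW.
pose d := e / 2 / (2 + t * s); have d0 : 0 < d by rewrite !divr_gt0 //; lra.
have de : 2 * d + t * s * d = e / 2 by rewrite -mulrDl /d mulrC divfK //; lra.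
have [f' [g' [Wfg h1 h2]]] := H r hr d d0.
have e2 : 0 < e / 2 by lra.
have := Wfg q hq s s0 (e / 2) e2 => Wn.
near=> n => k kn.
have n0 : (0 < n)%N by near: n; exact: nbhs_infty_gt.
have h3 : q (chernoff_defect n k f' g') <= e / 2.
  by move: k kn; near: n.
rewrite -[chernoff_defect _ _ _ _](subrK (chernoff_defect n k f' g')).
rewrite -chernoff_defectB; apply: le_trans (rsnD sq _ _) _.
have := chernoff_defect_le hq qr Hr (f - f') (g - g') n0 kn.
rewrite (rsnBC sr f) (rsnBC sr g).
have h4 := step_le n0 kn; have h5 := rsn_ge0 sr (g' - g).
have h6 : 0 <= k%:R * step n by rewrite mulr_ge0 // step_ge0.
nra.
Unshelve. all: by end_near. Qed.

Lemma chernoff_graphB f g f' g' : chernoff_graph (f, g) ->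
  chernoff_graph (f', g') -> chernoff_graph (f - f', g - g').
Proof.
move=> W W' q hq s s0 e e0 /=; have e2 : 0 < e / 2 by lra.
have Wn := W q hq s s0 _ e2; have Wn' := W' q hq s s0 _ e2.
near=> n => k kn; rewrite chernoff_defectB.
apply: le_trans (rsnB (basic_seminormP hp hq) _ _) _.
have h1 : q (chernoff_defect n k f g) <= e / 2 by move: k kn; near: n.
have h2 : q (chernoff_defect n k f' g') <= e / 2.
  by move: {h1} k kn; near: n.
lra.
Unshelve. all: by end_near. Qed.

(** Up to an error that vanishes with n, orbits of points in the domain of W are Lipschitz in time.
    The seminorm [r] comes before the pair (f, g), so that approximants can later be chosen with
    respect to it. *)
Lemma chernoff_modulus q (s : R) : basic_seminorm p q -> 0 <= s ->
  exists2 r, basic_seminorm p r & forall f g, chernoff_graph (f, g) ->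
    forall e : R, 0 < e -> \forall n \near \oo, forall k, k%:R <= n%:R * s ->
      q (Q n k f - f) <= e + k%:R * step n * r g.
Proof.
move=> hq s0; have [r hr [qr Hr]] := chernoff_bound hq s0.
have sq := basic_seminormP hp hq.
exists r => // f g W e e0; have Wn := W q hq s s0 _ e0.
near=> n => k kn.
have n0 : (0 < n)%N by near: n; exact: nbhs_infty_gt.
have h1 : q (chernoff_defect n k f g) <= e by move: k kn; near: n.
rewrite -[Q n k f - f](subrK (of_real (step n) *: \sum_(j < k) Q n j g)).
apply: le_trans (rsnD sq _ _) _; rewrite (rsnZr sq) ger0_norm ?step_ge0 //.
have h4 : q (\sum_(j < k) Q n j g) <= k%:R * r g.
  apply: (rsn_sum_le sq) => j jk; apply: Hr => //; apply: le_trans kn.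
  by rewrite ler_nat ltnW.
have h0 := step_ge0 n.
move: h1; rewrite /chernoff_defect; nra.
Unshelve. all: by end_near. Qed.

(* F_n^j v - v is not estimated directly, but through a nearby a in the domain
   of W, on which the iterates move at speed at most [r b]. *)
Lemma chernoff_block q (s : R) : basic_seminorm p q -> 0 <= s ->
  exists2 r, basic_seminorm p r & (forall x, q x <= r x) /\
    forall u v a b, chernoff_graph (u, v) -> chernoff_graph (a, b) ->
    forall e : R, 0 < e -> \forall n \near \oo, forall k, k%:R <= n%:R * s ->
      q (Q n k u - u - of_real (k%:R * step n) *: v) <=
      e + k%:R * step n * (2 * r (v - a) + k%:R * step n * r b).
Proof.
move=> hq s0; have [r1 hr1 [qr1 Hr1]] := chernoff_bound hq s0.
have [r2 hr2 Hr2] := chernoff_modulus hq s0.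
have sq := basic_seminormP hp hq; have sr1 := basic_seminormP hp hr1.
have sr2 := basic_seminormP hp hr2.
exists (fun x => r1 x + r2 x); first exact: basicD.
split=> [x|u v a b Wu Wa e e0].
  by have := qr1 x; have := rsn_ge0 sr2 x; lra.
have ts0 : 0 <= t * s by rewrite mulr_ge0 // ltW.
(* The error d enters once through the defect of (u, v), and with total weight at most ts through
   the motion of a. *)
pose d := e / (1 + t * s); have d0 : 0 < d by rewrite divr_gt0 //; lra.
have de : d + t * s * d = e by rewrite -[X in X + _]mul1r -mulrDl /d mulrC divfK //; lra.
have Wn := Wu q hq s s0 _ d0; have an := Hr2 a b Wa _ d0.
near=> n => k kn.
have n0 : (0 < n)%N by near: n; exact: nbhs_infty_gt.
have h1 : q (chernoff_defect n k u v) <= d by move: k kn; near: n.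
have h2 : forall j, j%:R <= n%:R * s ->
    q (Q n j a - a) <= d + j%:R * step n * r2 b by near: n.
have h0 := step_ge0 n.
set c := k%:R * step n * r2 b.
have h3 j : (j < k)%N -> q (Q n j v - v) <= 2 * r1 (v - a) + d + c.
  move=> jk; have jn : j%:R <= n%:R * s by apply: le_trans kn; rewrite ler_nat ltnW.
  have -> : Q n j v - v = Q n j (v - a) + (Q n j a - a) + (a - v).
    by rewrite iter_linearB !addrA subrK subrK.
  apply: le_trans (rsnD sq _ _) _; rewrite (rsnBC sq a).
  have := rsnD sq (Q n j (v - a)) (Q n j a - a).
  have := Hr1 n j (v - a) n0 jn; have := h2 j jn; have := qr1 (v - a).
  have : j%:R * step n * r2 b <= c.
    by rewrite /c ler_wpM2r ?(rsn_ge0 sr2) // ler_wpM2r // ler_nat ltnW.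
  lra.
(* The sum of the F_n^j v in the defect is replaced by k copies of v. *)
have -> : Q n k u - u - of_real (k%:R * step n) *: v = chernoff_defect n k u v +
    of_real (step n) *: \sum_(j < k) (Q n j v - v).
  rewrite /chernoff_defect sumrB scalerBr addrA subrK; congr (_ - _).
  by rewrite sumr_const card_ord -[v *+ k]scaler_nat scalerA -(rmorph_nat of_real) -rmorphM mulrC.
apply: le_trans (rsnD sq _ _) _; rewrite (rsnZr sq) ger0_norm //.
have h4 := rsn_sum_le sq h3.
have h5 := step_le n0 kn.
have h6 : 0 <= k%:R * step n by rewrite mulr_ge0.
have h7 := ler_wpM2l h0 h4.
have h8 := rsn_ge0 sr2 (v - a); have h9 := rsn_ge0 sr1 b.
have h10 : k%:R * step n * d <= t * s * d by rewrite ler_wpM2r // ltW.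
have h11 : 0 <= k%:R * step n * r2 (v - a) by rewrite mulr_ge0.
have h12 : 0 <= (k%:R * step n) * (k%:R * step n) * r1 b.
  by apply: mulr_ge0 => //; apply: mulr_ge0.
have h13 : step n * (k%:R * (2 * r1 (v - a) + d + c)) =
    k%:R * step n * (2 * r1 (v - a)) + k%:R * step n * d +
    (k%:R * step n) * (k%:R * step n) * r2 b by rewrite /c; ring.
have h14 : k%:R * step n *
      (2 * (r1 (v - a) + r2 (v - a)) + k%:R * step n * (r1 b + r2 b)) =
    k%:R * step n * (2 * r1 (v - a)) + 2 * (k%:R * step n * r2 (v - a)) +
    (k%:R * step n) * (k%:R * step n) * r1 b +
    (k%:R * step n) * (k%:R * step n) * r2 b by ring.
rewrite h14; rewrite h13 in h7; lra.
Unshelve. all: by end_near. Qed.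

End Chernoff.

(** Number of blocks that makes the second-order part of the error in [chernoff_blocks] small; c is
    the total duration and B the bound on the b i. *)
Lemma exists_mesh (R : realType) (c B e : R) : 0 <= c -> 0 <= B -> 0 < e ->
  exists2 L, (0 < L)%N & 2 * c * (c / L%:R * B) <= e.
Proof.
move=> c0 B0 e0; exists (Num.truncn (2 * c * c * B / e)).+1 => //.
have := truncnS_gt (2 * c * c * B / e); set L := (Num.truncn _).+1.
rewrite ltr_pdivrMr // => /ltW h.
have -> : 2 * c * (c / L%:R * B) = 2 * c * c * B / L%:R by field; rewrite gt_eqF.
by rewrite ler_pdivrMr // [leRHS]mulrC.
Qed.

Section ChernoffConvergence.
Context (R : realType) (T : scalar_kind) (X : tvsType (scalar_field R T)).
Local Notation K := (scalar_field R T).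
Context (Omega : Type) (p : Omega -> X -> K) (hp : generating_seminorms p).
Context (F : R -> bounded_op X) (t : R) (t_gt0 : 0 < t) (EF : E_class p F).

Local Notation step n := (t / n%:R).
Local Notation Q n k := (iter k (F (t / n%:R))).

Lemma truncn_mul_le (s r : R) n : 0 <= r -> r <= s ->
  (Num.truncn (n%:R * r))%:R <= n%:R * s.
Proof.
move=> r0 rs; apply: le_trans (ler_wpM2l (ler0n R n) rs).
by rewrite truncn_le mulr_ge0.
Qed.

Lemma truncn_mul_sub_le (s r r' : R) n : 0 <= r' -> r' <= s ->
  (Num.truncn (n%:R * r') - Num.truncn (n%:R * r))%N%:R <= n%:R * s.
Proof.
move=> r0 rs; apply: le_trans (truncn_mul_le n r0 rs).
by rewrite ler_nat leq_subr.
Qed.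

(** The block now has ends c and d independent of n. Its number of steps is a difference of integer
    parts, and the elapsed time only tends to t (d - c). *)
Lemma chernoff_block_step q (s : R) : basic_seminorm p q -> 0 <= s ->
  exists2 r, basic_seminorm p r & (forall x, q x <= r x) /\
    forall u v a b, chernoff_graph p F t (u, v) -> chernoff_graph p F t (a, b) ->
    forall c d : R, 0 <= c -> c <= d -> d <= s -> forall e : R, 0 < e ->
    \forall n \near \oo,
      q (Q n (Num.truncn (n%:R * d) - Num.truncn (n%:R * c))%N u - u
         - of_real (t * (d - c)) *: v) <=
      t * (d - c) * (2 * r (v - a) + t * (d - c) * r b) + e.
Proof.
move=> hq s0; have [r hr [qr Hr]] := chernoff_block hp t_gt0 EF hq s0.
have sq := basic_seminormP hp hq; have sr := basic_seminormP hp hr.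
exists r => //; split=> // u v a b Wu Wa c d c0 cd ds e e0.
set tau := t * (d - c).
have tau0 : 0 <= tau by rewrite mulr_ge0 ?subr_ge0 // ltW.
set A := r (v - a); set B := r b.
have A0 : 0 <= A := rsn_ge0 sr _; have B0 : 0 <= B := rsn_ge0 sr _.
have C0 : 0 <= q v := rsn_ge0 sq _.
(* If the elapsed time differs from tau by at most dl <= 1, the bound of [chernoff_block] grows by
   at most dl (2 A + (2 tau + 1) B), and replacing that time by tau in front of v costs dl (q v). *)
pose M := 2 * A + (2 * tau + 1) * B + q v.
have M0 : 0 <= M by rewrite /M; nra.
have e2 : 0 < e / 2 by lra.
pose dl := (e / 2) / (e / 2 + M).
have dl0 : 0 < dl by rewrite divr_gt0 //; lra.
have dl1 : dl <= 1 by rewrite ler_pdivrMr; lra.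
have dlM : dl * M <= e / 2.
  by rewrite /dl mulrAC ler_pdivrMr; [rewrite ler_wpM2l; lra|lra].
have H := truncn_sub_step_cvg (ltW t_gt0) c0 cd dl0.
have Hn := Hr u v a b Wu Wa _ e2.
near=> n.
have h1 : `|(Num.truncn (n%:R * d) - Num.truncn (n%:R * c))%N%:R * step n - tau| <= dl.
  by near: n.
have h2 : forall j, j%:R <= n%:R * s ->
    q (Q n j u - u - of_real (j%:R * step n) *: v) <=
    e / 2 + j%:R * step n * (2 * A + j%:R * step n * B) by near: n.
set k := (_ - _)%N in h1 *.
have kn : k%:R <= n%:R * s by apply: truncn_mul_sub_le => //; exact: le_trans cd.
have {}h2 := h2 k kn.
have hk0 : 0 <= k%:R * step n by rewrite mulr_ge0 // divr_ge0 // ltW.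
set hk := k%:R * step n in h1 h2 hk0.
have -> : Q n k u - u - of_real tau *: v =
    (Q n k u - u - of_real hk *: v) + of_real (hk - tau) *: v.
  by rewrite rmorphB /= scalerBl addrA subrK.
apply: le_trans (rsnD sq _ _) _; rewrite (rsnZr sq).
have h3 : `|hk - tau| * q v <= dl * q v by rewrite ler_wpM2r.
have h4 : hk <= tau + dl by move: h1; rewrite ler_norml => /andP[]; lra.
have h5 : hk * (2 * A) <= (tau + dl) * (2 * A) by rewrite ler_wpM2r //; lra.
have h6 : hk * hk * B <= (tau + dl) * (tau + dl) * B.
  by rewrite ler_wpM2r // ler_pM.
have h7 : dl * dl * B <= dl * 1 * B by rewrite ler_wpM2r // ler_wpM2l // ltW.
have h8 : hk * (2 * A + hk * B) = hk * (2 * A) + hk * hk * B by ring.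
have h9 : tau * (2 * A + tau * B) = tau * (2 * A) + tau * tau * B by ring.
have h10 : (tau + dl) * (2 * A) + (tau + dl) * (tau + dl) * B + dl * q v =
  tau * (2 * A) + tau * tau * B + dl * M + (dl * dl * B - dl * 1 * B).
  by rewrite /M; ring.
rewrite h8 in h2; rewrite h9; lra.
Unshelve. all: by end_near. Qed.

Lemma chernoff_seq0 f n : chernoff_seq F t 0 f n = f.
Proof. by rewrite /chernoff_seq mulr0 truncn0. Qed.

Lemma chernoff_seq_le q (s : R) : basic_seminorm p q -> 0 <= s ->
  exists2 r, basic_seminorm p r & (forall x, q x <= r x) /\
    forall n x (d : R), (0 < n)%N -> 0 <= d -> d <= s ->
      q (chernoff_seq F t d x n) <= r x.
Proof.
move=> hq s0; have [r hr [qr Hr]] := chernoff_bound hp t_gt0 EF hq s0.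
by exists r => //; split=> // n x d n0 d0 ds; apply: Hr => //; exact: truncn_mul_le.
Qed.

Lemma chernoff_seq_split (c d : R) f n : 0 <= c -> c <= d ->
  chernoff_seq F t d f n = Q n (Num.truncn (n%:R * c))
    (Q n (Num.truncn (n%:R * d) - Num.truncn (n%:R * c))%N f).
Proof.
move=> c0 cd; rewrite -iterD subnKC // le_truncn // ler_wpM2l //.
Qed.

(* The points u i, v i play the role of a solution u and of Zbar u at the time
   i s / L. *)
Lemma chernoff_blocks q (s : R) : basic_seminorm p q -> 0 < s ->
  exists2 r, basic_seminorm p r & (forall x, q x <= r x) /\
  forall L (u v a b : nat -> X) (eta B : R), (0 < L)%N ->
    (forall i, (i < L)%N -> [/\ chernoff_graph p F t (u i, v i),
      chernoff_graph p F t (a i, b i), r (v i - a i) <= eta, r (b i) <= B &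
      r (u i.+1 - u i - of_real (t * s / L%:R) *: v i) <=
        t * s / L%:R * (2 * eta + t * s / L%:R * B)]) ->
  forall e : R, 0 < e -> \forall n \near \oo,
    q (chernoff_seq F t s (u 0%N) n - u L) <=
    2 * (t * s) * (2 * eta + t * s / L%:R * B) + e.
Proof.
move=> hq s0; have [r1 hr1 [qr1 Hr1]] := chernoff_bound hp t_gt0 EF hq (ltW s0).
have [r hr [r1r Hr]] := chernoff_block_step hr1 (ltW s0).
have sq := basic_seminormP hp hq; have sr1 := basic_seminormP hp hr1.
have sr := basic_seminormP hp hr.
exists r => //; split=> [x|L u v a b eta B L0 H e e0].
  exact: le_trans (qr1 x) (r1r x).
set tau := t * s / L%:R in H *.
have L0' : 0 < L%:R :> R by rewrite ltr0n.
have tau0 : 0 <= tau by rewrite divr_ge0 ?mulr_ge0 // ltW.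
pose d i := i%:R * (s / L%:R) : R.
have d0 i : 0 <= d i by rewrite mulr_ge0 // divr_ge0 // ltW.
have dS i : d i <= d i.+1.
  by rewrite /d ler_wpM2r ?ler_nat // divr_ge0 // ltW.
have dL : d L = s by rewrite /d mulrC divfK // gt_eqF.
have dtau i : t * (d i.+1 - d i) = tau.
  by rewrite /d /tau -natr1; field; rewrite gt_eqF.
have d_le i : (i <= L)%N -> d i <= s.
  by move=> iL; rewrite -dL /d ler_wpM2r ?ler_nat // divr_ge0 // ltW.
pose N n i := Num.truncn (n%:R * d i).
have NS n i : (N n i <= N n i.+1)%N by rewrite le_truncn // ler_wpM2l.
pose e' := e / L%:R.
have e0' : 0 < e' by rewrite divr_gt0.
(* The factor 2 counts two deviations from the tangent step u i + tau v i: that of the iterates and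
   that of u i.+1. *)
have key : \forall n \near \oo, forall i : 'I_L,
    r1 (Q n (N n i.+1 - N n i)%N (u i) - u i.+1) <=
    2 * (tau * (2 * eta + tau * B)) + e'.
  apply: filter_forall => i; have [W1 W2 h1 h2 h3] := H i (ltn_ord i).
  have Hn := Hr _ _ _ _ W1 W2 _ _ (d0 i) (dS i) (d_le i.+1 (ltn_ord i)) _ e0'.
  near=> n.
  have h4 : r1 (Q n (N n i.+1 - N n i)%N (u i) - u i
      - of_real (t * (d i.+1 - d i)) *: v i) <=
     t * (d i.+1 - d i) * (2 * r (v i - a i) + t * (d i.+1 - d i) * r (b i)) + e'.
    by near: n.
  rewrite dtau in h4.
  have h5 : r1 (u i.+1 - u i - of_real tau *: v i) <= tau * (2 * eta + tau * B).
    exact: le_trans (r1r _) h3.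
  have -> : Q n (N n i.+1 - N n i)%N (u i) - u i.+1 =
     (Q n (N n i.+1 - N n i)%N (u i) - u i - of_real tau *: v i) -
     (u i.+1 - u i - of_real tau *: v i).
    by rewrite opprB addrA subrK opprB addrA subrK.
  apply: le_trans (rsnB sr1 _ _) _.
  have h6 : tau * (2 * r (v i - a i) + tau * r (b i)) <= tau * (2 * eta + tau * B).
    by rewrite ler_wpM2l // lerD // ler_wpM2l.
  lra.
near=> n.
have n0 : (0 < n)%N by near: n; exact: nbhs_infty_gt.
have keyn : forall i : 'I_L, r1 (Q n (N n i.+1 - N n i)%N (u i) - u i.+1) <=
    2 * (tau * (2 * eta + tau * B)) + e' by near: n.
(* [x i] runs the remaining steps from the i-th value: x 0 is the Chernoff iterate, x L is u L, and
   consecutive terms differ by the error of one block carried to the end. *)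
pose x i := Q n (N n L - N n i)%N (u i).
have NL i : (i <= L)%N -> (N n i <= N n L)%N.
  move=> iL; rewrite le_truncn // ler_wpM2l //.
  by rewrite /d ler_wpM2r ?ler_nat // divr_ge0 // ltW.
have -> : chernoff_seq F t s (u 0%N) n - u L = \sum_(i < L) (x i - x i.+1).
  have -> : u L = x L by rewrite /x subnn.
  have -> : chernoff_seq F t s (u 0%N) n = x 0%N.
    by rewrite /x /N dL /d mul0r mulr0 truncn0 subn0.
  elim: (L) => [|m IH]; first by rewrite big_ord0 subrr.
  by rewrite big_ord_recr /= -IH addrA subrK.
apply: (@le_trans _ _ (L%:R * (2 * (tau * (2 * eta + tau * B)) + e'))).
  apply: (rsn_sum_le sq (F := fun i => x i - x i.+1)) => i iL.
  have -> : x i - x i.+1 =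
      Q n (N n L - N n i.+1)%N (Q n (N n i.+1 - N n i)%N (u i) - u i.+1).
    have E : (N n L - N n i = N n L - N n i.+1 + (N n i.+1 - N n i))%N.
      by rewrite addnBA ?NS // subnK ?NL.
    by rewrite /x E iterD [RHS]iter_linearB.
  apply: le_trans (Hr1 _ _ _ n0 _) (keyn (Ordinal iL)).
  by rewrite /N dL; apply: truncn_mul_sub_le => //; exact: ltW.
have -> : L%:R * (2 * (tau * (2 * eta + tau * B)) + e') =
    2 * (L%:R * tau) * (2 * eta + tau * B) + L%:R * e' by ring.
have -> : L%:R * tau = t * s by rewrite /tau mulrC divfK // gt_eqF.
by have -> : L%:R * e' = e by rewrite /e' mulrC divfK // gt_eqF.
Unshelve. all: by end_near. Qed.

(** Iterates of 0 stay at 0, so a block of duration td yields q (td g) <= td (2 r (g - a) + td r b)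
    up to an arbitrary error. Division by td leaves a bound that is small once a is near g and,
    after that, d is small. *)
Lemma chernoff_graph_functional g : hausdorff_space X ->
  dense (domain (chernoff_graph p F t)) -> chernoff_graph p F t (0, g) -> g = 0.
Proof.
move=> hX dW Wg; apply: (hausdorff_basic_eq hp hX) => q hq e e0; rewrite subr0.
have [r hr [qr Hr]] := chernoff_block_step hq ler01.
have sq := basic_seminormP hp hq; have sr := basic_seminormP hp hr.
have e4 : 0 < e / 8 by lra.
have [a [b Wa] ag] := (dense_basicP hp _).1 dW g r hr _ e4.
rewrite (rsnBC sr) in ag.
have B0 := rsn_ge0 sr b.
pose M := t * (r b + 1) / (e / 4) + 1; have M1 : 1 <= M.
  by rewrite lerDr divr_ge0 ?mulr_ge0 //; have := t_gt0; lra.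
pose d := M^-1.
have d0 : 0 < d by rewrite invr_gt0; lra.
have d1 : d <= 1 by rewrite invf_le1; lra.
have td0 : 0 < t * d by rewrite mulr_gt0.
have tdB : t * d * r b <= e / 4.
  rewrite mulrAC ler_pdivrMr; last lra.
  rewrite /M mulrDr mulr1 [_ * (_ / _)]mulrC divfK; last by apply: lt0r_neq0; lra.
  have := t_gt0; nra.
have tde : 0 < t * d * (e / 8) by rewrite mulr_gt0.
have := Hr _ _ _ _ Wg Wa 0 d (lexx 0) (ltW d0) d1 _ tde.
rewrite subr0 => Hn; near \oo => n.
have : q (Q n (Num.truncn (n%:R * d) - Num.truncn (n%:R * (0 : R)))%N 0 - 0
    - of_real (t * d) *: g) <= t * d * (2 * r (g - a) + t * d * r b) + t * d * (e / 8).
  by near: n.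
rewrite iter_linear0 subrr sub0r (rsnN sq) (rsnZr sq) gtr0_norm // -mulrDr ler_pM2l //.
lra.
Unshelve. all: by end_near. Qed.

End ChernoffConvergence.

(** * Weak limits of the iterates and the Cauchy property *)

Section WeakLimits.
Context (R : realType) (T : scalar_kind) (X : tvsType (scalar_field R T)).
Local Notation K := (scalar_field R T).
Context (Omega : Type) (p : Omega -> X -> K) (hp : generating_seminorms p).
Context (hX : hausdorff_space X).
Context (F : R -> bounded_op X) (t : R) (t_gt0 : 0 < t) (EF : E_class p F).
Local Notation P := (chernoff_seq F t).

Context (weak_compactness : forall (s : R) (f : X), 0 < s ->
  forall sigma, subsequence_index sigma ->
  exists tau l, subsequence_index tau /\
    weak_cvg p (fun k => P s f (sigma (tau k))) l).

(** Extraction is repeated over a finite list of times and points, which is all a partition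
    requires. Time 0, not covered by the compactness hypothesis, gives constant sequences. *)
Lemma common_weak_subsequence (zs : seq (R * X)) :
  (forall z, z \in zs -> 0 <= z.1) ->
  exists2 tau, subsequence_index tau & forall z, z \in zs ->
    exists l, weak_cvg p (fun k => P z.1 z.2 (tau k)) l.
Proof.
elim: zs => [|z zs IH] H; first by exists id.
have [|tau htau Htau] := IH; first by move=> y yzs; apply: H; rewrite inE yzs orbT.
have z0 : 0 <= z.1 by apply: H; rewrite mem_head.
have [z1|z1|z1] := ltgtP 0 z.1; last 2 first.
- by rewrite ltNge z0 in z1.
- exists tau => // y; rewrite inE => /orP[/eqP ->|/Htau//].
  exists z.2; apply: cvg_weak_cvg; rewrite -z1.
  by under eq_fun do rewrite chernoff_seq0; exact: cvg_cst.
have [tau' [l [htau' Hl]]] := weak_compactness z.2 z1 htau.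
exists (tau \o tau'); first by move=> i j ij; apply: htau; exact: htau'.
move=> y; rewrite inE => /orP[/eqP ->|/Htau[l' Hl']]; first by exists l.
by exists l'; exact: (weak_cvg_subseq htau' Hl').
Qed.

Context (Z : set (X * X)) (subZ : is_subspace Z).
Context (ZW : Z `<=` chernoff_graph p F t).
Context (A : set X) (AZ : A `<=` domain Z) (dA : dense A).

Context (weak_invariance : forall (f g : X) (s : R), A f -> Z (f, g) -> 0 <= s ->
  exists f_ g_ : nat -> X, [/\ forall n, closure Z (f_ n, g_ n),
    weak_cvg p (fun n => P s f n - f_ n) 0
  & weak_cvg p (fun n => P s g n - g_ n) 0]).

Lemma closure_chernoff_graph : closure Z `<=` chernoff_graph p F t.
Proof.
by apply: subset_trans (chernoff_graph_closed hp t_gt0 EF); exact: closure_subset.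
Qed.

(** Condition (iv) trades the iterates, which need not lie in a domain, for pairs in the closure of
    Z with the same weak limits; the closure of a subspace is weakly sequentially closed. *)
Lemma weak_limit_closure f g (s : R) tau u v : A f -> Z (f, g) -> 0 <= s ->
  subsequence_index tau -> weak_cvg p (fun k => P s f (tau k)) u ->
  weak_cvg p (fun k => P s g (tau k)) v -> closure Z (u, v).
Proof.
move=> Af Zfg s0 htau fu gv.
have [f_ [g_ [Zn h1 h2]]] := weak_invariance Af Zfg s0.
have E (x : X) : x = x - 0 by rewrite subr0.
apply: (weak_closure hp subZ (f := f_ \o tau) (g := g_ \o tau)).
- by move=> n; exact: Zn.
- rewrite (E u); have := weak_cvgB fu (weak_cvg_subseq htau h1).
  by under eq_fun do rewrite /= opprB addrC subrK.
- rewrite (E v); have := weak_cvgB gv (weak_cvg_subseq htau h2).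
  by under eq_fun do rewrite /= opprB addrC subrK.
Qed.

(** The weak limits of P f, P g, P a, P b at the partition points, along one common subsequence,
    meet the hypotheses of [chernoff_blocks]: each inequality holds for the iterates and passes to
    the limit. The conclusion then concerns the full sequence. *)
Lemma chernoff_seq_near_cauchy f (s : R) q (e : R) : A f -> 0 <= s ->
  basic_seminorm p q -> 0 < e ->
  exists l, \forall n \near \oo, q (P s f n - l) < e.
Proof.
move=> Af s0 hq e0; have sq := basic_seminormP hp hq.
move: s0; rewrite le_eqVlt => /orP[/eqP <-|s0].
  by exists f; apply: nearW => n; rewrite chernoff_seq0 subrr (rsn0 sq).
have [g Zfg] := AZ Af.
(* [r1] serves the telescoping, [r2] absorbs the iterates up to a partition point, [r3] measures one
   block started at time 0. *)
have [r1 hr1 [qr1 blocks]] := chernoff_blocks hp t_gt0 EF hq s0.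
have [r2 hr2 [r1r2 bound]] := chernoff_seq_le hp t_gt0 EF hr1 (ltW s0).
have [r3 hr3 [r2r3 block]] := chernoff_block_step hp t_gt0 EF hr2 (ltW s0).
have sr1 := basic_seminormP hp hr1; have sr2 := basic_seminormP hp hr2.
have sr3 := basic_seminormP hp hr3.
have ts0 : 0 < t * s by rewrite mulr_gt0.
(* Makes the first-order part of the error e/5; the mesh and the remainder in [chernoff_blocks] take
   e/5 each. *)
pose eta := e / 5 / (4 * (t * s)).
have eta0 : 0 < eta by rewrite divr_gt0 //; lra.
have etaE : 2 * (t * s) * (2 * eta) = e / 5.
  by rewrite /eta mulrC; field; rewrite !gt_eqF.
have [a Aa ga] := (dense_basicP hp _).1 dA g r3 hr3 eta eta0.
rewrite (rsnBC sr3) in ga.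
have [b Zab] := AZ Aa.
pose B := r3 b; have B0 : 0 <= B := rsn_ge0 sr3 b.
have e5 : 0 < e / 5 by lra.
have [L L_gt0 LB] := exists_mesh (ltW ts0) B0 e5.
have L0 : 0 < L%:R :> R by rewrite ltr0n.
pose d i := i%:R * (s / L%:R) : R.
have d0 i : 0 <= d i by rewrite mulr_ge0 // divr_ge0 // ltW.
have dS i : d i <= d i.+1.
  by rewrite /d ler_wpM2r ?ler_nat // divr_ge0 // ltW.
have d_le i : (i <= L)%N -> d i <= s.
  move=> iL; rewrite -[leRHS](divfK (lt0r_neq0 L0)) mulrC.
  by rewrite /d ler_wpM2r ?ler_nat // divr_ge0 // ltW.
pose tau_ := t * s / L%:R.
have dtau i : t * (d i.+1 - d i) = tau_.
  by rewrite /d /tau_ -natr1; field; rewrite gt_eqF.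
have tau0 : 0 <= tau_ by rewrite divr_ge0 // ltW.
pose ys := [:: f; g; a; b].
have [|sigma hsigma Hsigma] :=
    @common_weak_subsequence [seq (d i, y) | i <- iota 0 L.+1, y <- ys].
  by move=> _ /allpairsP[[i y] [_ _ ->]]; exact: d0.
pose lim i y := xget 0 [set l | weak_cvg p (fun k => P (d i) y (sigma k)) l].
have limP i y : (i <= L)%N -> y \in ys ->
    weak_cvg p (fun k => P (d i) y (sigma k)) (lim i y).
  move=> iL yys; have [|l Hl] := Hsigma (d i, y).
    by apply: allpairs_f => //; rewrite mem_iota add0n ltnS.
  by rewrite /lim; case: xgetP => [l' -> //|/(_ l)].
have [fys gys ays bys] : [/\ f \in ys, g \in ys, a \in ys & b \in ys].
  by split; rewrite !inE eqxx ?orbT.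
have limfE : lim 0%N f = f.
  have H0 := limP 0%N f (leq0n _) fys.
  apply: (hausdorff_basic_eq hp hX) => r hr c c0; apply: le_lt_trans c0.
  apply: (weak_cvg_seminorm_le hp hr (weak_cvgB H0 (cvg_weak_cvg (cvg_cst f)))).
  apply: nearW => k; rewrite /d mul0r chernoff_seq0 subrr.
  by rewrite (rsn0 (basic_seminormP hp hr)).
exists (lim L f).
have key : forall i, (i < L)%N -> [/\ chernoff_graph p F t (lim i f, lim i g),
      chernoff_graph p F t (lim i a, lim i b), r1 (lim i g - lim i a) <= eta,
      r1 (lim i b) <= B &
      r1 (lim i.+1 f - lim i f - of_real tau_ *: lim i g) <=
        tau_ * (2 * eta + tau_ * B)].
  move=> i iL; have iL' := ltnW iL.
  have bnd y n : (0 < n)%N -> r1 (P (d i) y n) <= r2 y.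
    by move=> n0; apply: bound => //; exact: d_le.
  have sn n : (0 < n)%N -> (0 < sigma n)%N.
    by move=> n0; exact: leq_trans n0 (leq_subseq_index n hsigma).
  split.
  - apply: closure_chernoff_graph.
    exact: (weak_limit_closure Af Zfg (d0 i) hsigma (limP i f iL' fys) (limP i g iL' gys)).
  - apply: closure_chernoff_graph.
    exact: (weak_limit_closure Aa Zab (d0 i) hsigma (limP i a iL' ays) (limP i b iL' bys)).
  - apply: (weak_cvg_seminorm_le hp hr1 (weak_cvgB (limP i g iL' gys) (limP i a iL' ays))).
    near=> n; rewrite /chernoff_seq -iter_linearB.
    apply: le_trans (bnd (g - a) (sigma n) _) _.
      by apply: sn; near: n; exact: nbhs_infty_gt.
    by apply: ltW; apply: le_lt_trans (r2r3 _) ga.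
  - apply: (weak_cvg_seminorm_le hp hr1 (limP i b iL' bys)).
    near=> n; apply: le_trans (bnd b (sigma n) _) (r2r3 _).
    by apply: sn; near: n; exact: nbhs_infty_gt.
  - apply/ler_addgt0Pr => c c0.
    have Hn := block f g a b (ZW Zfg) (ZW Zab) _ _ (d0 i) (dS i) (d_le _ iL) _ c0.
    have cs := cvg_subseq_index hsigma.
    have {}Hn := cs _ Hn.
    apply: (weak_cvg_seminorm_le hp hr1 (weak_cvgB
      (weak_cvgB (limP i.+1 f iL fys) (limP i f iL' fys))
      (weak_cvgZ (a := of_real tau_) (limP i g iL' gys)))).
    near=> n.
    have n0 : (0 < sigma n)%N by apply: sn; near: n; exact: nbhs_infty_gt.
    set m := sigma n in n0 *.
    (* Powers of one operator commute, so the increment over the i-th block is [P (d i)] applied to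
       an increment from the fixed pair (f, g), for which [block] is available. *)
    pose y := iter (Num.truncn (m%:R * d i.+1) - Num.truncn (m%:R * d i))%N
      (F (t / m%:R)) f - f - of_real tau_ *: g.
    have -> : P (d i.+1) f m - P (d i) f m - of_real tau_ *: P (d i) g m = P (d i) y m.
      rewrite (chernoff_seq_split _ _ _ _ (d0 i) (dS i)) /chernoff_seq.
      by rewrite -iter_linearZ -!iter_linearB.
    apply: le_trans (bnd y m n0) _.
    rewrite /y /m.
    rewrite -(dtau i); apply: (@le_trans _ _ (t * (d i.+1 - d i) *
      (2 * r3 (g - a) + t * (d i.+1 - d i) * r3 b) + c)); first by near: n.
    rewrite lerD2r dtau; apply: ler_wpM2l => //.
    by rewrite lerD2r; move: ga; lra.
have := blocks L (lim^~ f) (lim^~ g) (lim^~ a) (lim^~ b) eta B L_gt0 key _ e5.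
apply: filterS => n; rewrite limfE => h; apply: le_lt_trans h _.
rewrite mulrDr etaE -/tau_; move: LB; rewrite -/tau_; lra.
Unshelve. all: by end_near. Qed.

End WeakLimits.

(** * Integrals and generators of semigroups *)

Section StrongLimits.
Context (R : realType) (T : scalar_kind) (X : tvsType (scalar_field R T)).
Local Notation K := (scalar_field R T).
Context (Omega : Type) (p : Omega -> X -> K) (hp : generating_seminorms p).

Lemma tvs_cvgD (u v : nat -> X) x y : u @ \oo --> x -> v @ \oo --> y ->
  (fun n => u n + v n) @ \oo --> x + y.
Proof.
move=> ux vy; exact: (cvg_comp2 ux vy (@add_continuous X (x, y))).
Qed.

Lemma tvs_cvgZ (a : K) (u : nat -> X) x : u @ \oo --> x ->
  (fun n => a *: u n) @ \oo --> a *: x.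
Proof.
move=> ux; apply: (cvg_comp2 (cvg_cst (a : K^o)) ux (@scale_continuous K X (a, x))).
Qed.

Lemma tvs_cvgB (u v : nat -> X) x y : u @ \oo --> x -> v @ \oo --> y ->
  (fun n => u n - v n) @ \oo --> x - y.
Proof.
move=> ux vy; have := tvs_cvgD ux (tvs_cvgZ (a := -1) vy).
by rewrite scaleN1r; under eq_fun do rewrite scaleN1r.
Qed.

Lemma tvs_cvg_unique (hX : hausdorff_space X) (u : nat -> X) (x y : X) :
  u @ \oo --> x -> u @ \oo --> y -> x = y.
Proof. by move=> ux uy; exact: (@cvg_unique _ hX _ _ x y ux uy). Qed.

Lemma cvg_seminorm_le q (u : nat -> X) x (c : R) : basic_seminorm p q ->
  u @ \oo --> x -> (\forall n \near \oo, q (u n) <= c) -> q x <= c.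
Proof.
by move=> hq ux; exact: (weak_cvg_seminorm_le hp hq (cvg_weak_cvg ux)).
Qed.

Lemma cvg_bounded_op (G : bounded_op X) (u : nat -> X) x : u @ \oo --> x ->
  (fun n => G (u n)) @ \oo --> G x.
Proof. exact: continuous_cvg (@op_continuous _ _ G x). Qed.

End StrongLimits.

Lemma iter_additive (R : realType) (Y : Type) (S : R -> Y -> Y) :
  (forall x, S 0 x = x) ->
  (forall l m x, 0 <= l -> 0 <= m -> S (l + m) x = S l (S m x)) ->
  forall d k x, 0 <= d -> iter k (S d) x = S (k%:R * d) x.
Proof.
move=> S0 SD d k x d0; elim: k => [|k IH]; first by rewrite mul0r S0.
by rewrite iterS IH -SD ?mulr_ge0 // -nat1r mulrDl mul1r.
Qed.

Section Semigroup.
Context (R : realType) (T : scalar_kind) (X : tvsType (scalar_field R T)).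
Local Notation K := (scalar_field R T).
Context (Omega : Type) (p : Omega -> X -> K) (hp : generating_seminorms p).
Context (hX : hausdorff_space X) (cX : complete_space X).
Context (S : R -> bounded_op X) (hS : lC0_semigroup p S).

Lemma semigroup0 x : S 0 x = x.
Proof. by case: hS. Qed.

Lemma semigroupD l m x : 0 <= l -> 0 <= m -> S (l + m) x = S l (S m x).
Proof. by case: hS => _ _ SD _ l0 m0; exact: SD. Qed.

Lemma semigroup_E_class : E_class p S.
Proof. by case: hS. Qed.

Lemma semigroup_iter (d : R) k x : 0 <= d -> iter k (S d) x = S (k%:R * d) x.
Proof.
move=> d0; apply: (iter_additive (S := fun r => S r : X -> X)) => //.
  exact: semigroup0.
by move=> l m y; exact: semigroupD.
Qed.

Lemma semigroup_bound q (s : R) : basic_seminorm p q -> 0 <= s ->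
  exists2 r, basic_seminorm p r & (forall x, q x <= r x) /\
    forall d x, 0 <= d -> d <= s -> q (S d x) <= r x.
Proof.
move=> hq s0; have [_ EE] := semigroup_E_class.
have [r hr Hr] := (basic_equicontinuousP hp _).1 (EE _ s0) q hq.
have H d x : 0 <= d -> d <= s -> q (S d x) <= r x.
  move=> d0 ds; apply: (Hr (S d)); exists d, 1%N, 1%N.
  by rewrite mul1r divr1; split=> //=; rewrite divr1.
exists r => //; split=> // x.
by have := H 0 x (lexx 0) s0; rewrite semigroup0.
Qed.

Lemma semigroup_continuous0 q x (e : R) : basic_seminorm p q -> 0 < e ->
  exists2 dl : R, 0 < dl & forall d, 0 <= d -> d <= dl -> q (S d x - x) < e.
Proof.
move=> hq e0; have [/subspace_continuousP/(_ 0 (lexx 0)) + _ _ _] := hS.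
move=> /cvg_bounded_opP/(_ x)/(basic_cvgP hp _ _)/(_ q hq e e0).
rewrite /within /= => /nbhs_ballP[dl /= dl0 H].
exists (dl / 2); first by lra.
move=> d d0 dd; have := H d; rewrite semigroup0; apply=> //.
by rewrite /ball /= sub0r normrN ger0_norm //; lra.
Qed.

(** Times approach h from below, so S h x = S (d n) (S (h - d n) x) and continuity at time 0 is
    enough. *)
Lemma semigroup_cvg (h : R) (d : nat -> R) (y : nat -> X) x :
  (forall n, 0 <= d n) -> (forall n, d n <= h) ->
  (forall e, 0 < e -> \forall n \near \oo, h - e <= d n) ->
  y @ \oo --> x -> (fun n => S (d n) (y n)) @ \oo --> S h x.
Proof.
move=> d0 dh dlim yx; apply/(basic_cvgP hp) => q hq e e0.
have sq := basic_seminormP hp hq.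
have h0 : 0 <= h := le_trans (d0 0%N) (dh 0%N).
have [r hr [qr Hr]] := semigroup_bound hq h0.
have e2 : 0 < e / 2 by lra.
have [dl dl0 Hdl] := semigroup_continuous0 x hr e2.
have H1 : \forall n \near \oo, r (y n - x) < e / 2.
  exact: (basic_cvgP hp _ _).1 yx r hr _ e2.
have H2 : \forall n \near \oo, h - dl <= d n := dlim _ dl0.
near=> n.
have h1 : r (y n - x) < e / 2 by near: n.
have h2 : h - dl <= d n by near: n.
have -> : S (d n) (y n) - S h x = S (d n) (y n - x) - S (d n) (S (h - d n) x - x).
  rewrite !(linearB (S (d n))) -semigroupD ?subr_ge0 //.
  by rewrite [d n + _]addrC subrK opprB addrA subrK.
apply: le_lt_trans (rsnB sq _ _) _.
have h3 := Hr (d n) (y n - x) (d0 n) (dh n).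
have h4 := Hr (d n) (S (h - d n) x - x) (d0 n) (dh n).
have h5 : r (S (h - d n) x - x) < e / 2.
  by apply: Hdl; rewrite ?subr_ge0 // lerBlDr -lerBlDl.
lra.
Unshelve. all: by end_near. Qed.

(** The mesh is 1/n whatever a is: sums over different intervals share one grid, which makes
    [riemann_sum_exchange] an exact identity. *)
Definition riemann_sum (a : R) x (n : nat) : X :=
  of_real n%:R^-1 *: \sum_(k < Num.truncn (n%:R * a)) S (k%:R / n%:R) x.

Lemma truncn_div_le (a : R) n k : 0 <= a -> (k <= Num.truncn (n%:R * a))%N ->
  k%:R / n%:R <= a.
Proof.
move=> a0; case: n => [|n]; first by rewrite invr0 mulr0.
by rewrite truncn_ge_nat ?mulr_ge0 // ler_pdivrMr // mulrC.
Qed.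

Lemma riemann_sum_linear a n (c : K) x y :
  riemann_sum a (c *: x + y) n = c *: riemann_sum a x n + riemann_sum a y n.
Proof.
rewrite /riemann_sum; under eq_bigr do rewrite linearP.
by rewrite big_split /= -scaler_sumr scalerDr !scalerA mulrC.
Qed.

Lemma riemann_sum_le q (a c : R) x n : basic_seminorm p q -> 0 <= a ->
  (forall d, 0 <= d -> d <= a -> q (S d x) <= c) -> q (riemann_sum a x n) <= a * c.
Proof.
move=> hq a0 H; have sq := basic_seminormP hp hq.
rewrite /riemann_sum (rsnZr sq) ger0_norm ?invr_ge0 //.
set m := Num.truncn _.
have h1 : q (\sum_(k < m) S (k%:R / n%:R) x) <= m%:R * c.
  apply: (rsn_sum_le sq (F := fun k => S (k%:R / n%:R) x)) => k km.
  by apply: H; rewrite ?divr_ge0 //; apply: truncn_div_le => //; exact: ltnW.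
have c0 : 0 <= c by apply: le_trans (H 0 (lexx 0) a0); exact: (rsn_ge0 sq).
have n0 : 0 <= n%:R^-1 :> R by rewrite invr_ge0.
apply: le_trans (ler_wpM2l n0 h1) _; rewrite mulrA ler_wpM2r // mulrC.
exact: truncn_div_le.
Qed.

Lemma sum_ord_mul (G : nat -> X) M m :
  \sum_(j < M * m) G j = \sum_(k < M) \sum_(i < m) G (k * m + i)%N.
Proof.
elim: M => [|M IH]; first by rewrite mul0n !big_ord0.
by rewrite mulSnr big_split_ord /= IH [RHS]big_ord_recr.
Qed.

(* Refining the mesh from 1/n to 1/(nm) moves each point by at most 1/n and
   adds fewer than m points at the end. *)
Lemma riemann_sum_refine q (a c e : R) x n m : basic_seminorm p q -> 0 <= a ->
  (0 < n)%N -> (0 < m)%N -> (forall d, 0 <= d -> d <= a -> q (S d x) <= c) ->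
  (forall d d', 0 <= d -> d <= a -> 0 <= d' -> d' <= n%:R^-1 ->
     q (S d x - S (d + d') x) <= e) ->
  q (riemann_sum a x n - riemann_sum a x (n * m)) <= a * e + n%:R^-1 * c.
Proof.
move=> hq a0 n0 m0 Hc He; have sq := basic_seminormP hp hq.
have n0' : 0 < n%:R :> R by rewrite ltr0n.
have m0' : 0 < m%:R :> R by rewrite ltr0n.
rewrite /riemann_sum; set M := Num.truncn (n%:R * a).
set M' := Num.truncn ((n * m)%:R * a).
have /andP[M1 M2] := truncn_itv (mulr_ge0 (ltW n0') a0).
have /andP[M3 M4] := truncn_itv (mulr_ge0 (ler0n R (n * m)) a0).
have MM : (M * m <= M')%N.
  rewrite truncn_ge_nat ?mulr_ge0 // !natrM mulrAC ler_wpM2r //.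
have MM' : (M' - M * m < m)%N.
  rewrite ltn_subLR // -(ltr_nat R) natrD natrM; apply: le_lt_trans M3 _.
  by rewrite natrM; have := M2; rewrite -/M -natr1 -(ltr_pM2r m0') mulrDl; lra.
have c0 : 0 <= c by apply: le_trans (Hc 0 (lexx 0) a0); exact: (rsn_ge0 sq).
have e0 : 0 <= e.
  by apply: le_trans (He 0 0 (lexx 0) a0 (lexx 0) _); rewrite ?invr_ge0 // (rsn_ge0 sq).
pose G j := S (j%:R / (n * m)%:R) x.
have -> : \sum_(j < M') G j = \sum_(k < M) \sum_(i < m) G (k * m + i)%N +
    \sum_(j < M' - M * m) G (M * m + j)%N.
  rewrite -sum_ord_mul -[in LHS](subnKC MM); exact: big_split_ord.
(* Each coarse point is repeated m times, to be compared with the m fine points that follow it. *)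
have -> : of_real n%:R^-1 *: \sum_(k < M) S (k%:R / n%:R) x =
    of_real (n * m)%:R^-1 *: \sum_(k < M) \sum_(i < m) S (k%:R / n%:R) x.
  under [in RHS]eq_bigr do rewrite sumr_const card_ord -scaler_nat.
  rewrite -scaler_sumr scalerA; congr (_ *: _).
  rewrite -(rmorph_nat of_real) -rmorphM natrM invfM -mulrA mulVf ?mulr1 //.
  by rewrite gt_eqF.
rewrite -scalerBr opprD addrA -sumrB (rsnZr sq) ger0_norm ?invr_ge0 //.
have h1 : q (\sum_(k < M) (\sum_(i < m) S (k%:R / n%:R) x -
    \sum_(i < m) G (k * m + i)%N)) <= M%:R * (m%:R * e).
  apply: (rsn_sum_le sq (F := fun k => \sum_(i < m) S (k%:R / n%:R) x -
    \sum_(i < m) G (k * m + i)%N)) => k kM.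
  rewrite -sumrB.
  apply: (rsn_sum_le sq (F := fun i => S (k%:R / n%:R) x - G (k * m + i)%N)) => i im.
  rewrite /G natrD natrM mulrDl natrM -mulf_div divff ?gt_eqF // mulr1.
  apply: He; rewrite ?divr_ge0 ?mulr_ge0 //.
    by apply: truncn_div_le => //; exact: ltnW.
  rewrite ler_pdivrMr ?mulr_gt0 // mulrA mulVf ?gt_eqF // mul1r ler_nat.
  exact: ltnW.
have h2 : q (\sum_(j < M' - M * m) G (M * m + j)%N) <= (M' - M * m)%N%:R * c.
  apply: (rsn_sum_le sq (F := fun j => G (M * m + j)%N)) => j jM.
  apply: Hc; first by rewrite divr_ge0.
  by apply: truncn_div_le => //; move: jM; rewrite ltn_subRL => /ltnW.
have h3 := rsnB sq (\sum_(k < M) (\sum_(i < m) S (k%:R / n%:R) x -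
    \sum_(i < m) G (k * m + i)%N)) (\sum_(j < M' - M * m) G (M * m + j)%N).
have h4 : (M' - M * m)%N%:R * c <= m%:R * c by rewrite ler_wpM2r // ler_nat ltnW.
have h5 : M%:R * (m%:R * e) <= n%:R * a * (m%:R * e).
  by rewrite ler_wpM2r // mulr_ge0.
rewrite natrM ler_pdivrMl ?mulr_gt0 //.
have -> : n%:R * m%:R * (a * e + n%:R^-1 * c) = n%:R * a * (m%:R * e) + m%:R * c.
  by field; rewrite gt_eqF.
lra.
Qed.

Lemma riemann_sum_cvg (a : R) x : 0 <= a -> exists y : X, riemann_sum a x @ \oo --> y.
Proof.
move=> a0; apply: (complete_seq_cvg hp cX) => q hq e e0.
have sq := basic_seminormP hp hq.
have a10 : 0 <= a + 1 by lra.
have [r hr [qr Hr]] := semigroup_bound hq a10.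
have sr := basic_seminormP hp hr; have r0 := rsn_ge0 sr x.
pose e1 := e / 8 / (a + 1); have e10 : 0 < e1 by rewrite !divr_gt0 //; lra.
have ae1 : a * e1 <= e / 8.
  by rewrite /e1 mulrA ler_pdivrMr; [nra|lra].
have [dl dl0 Hdl] := semigroup_continuous0 x hr e10.
pose good n := (0 < n)%N /\ n%:R^-1 <= dl /\ n%:R^-1 * r x <= e / 8.
have Hg : \forall n \near \oo, good n.
  near=> n.
  have n0 : (0 < n)%N by near: n; exact: nbhs_infty_gt.
  have n0' : 0 < n%:R :> R by rewrite ltr0n.
  have h1 : dl^-1 <= n%:R by near: n; exact: nbhs_infty_ger.
  have h2 : r x / (e / 8) <= n%:R by near: n; exact: nbhs_infty_ger.
  split=> //; split; first by rewrite -[dl]invrK lef_pV2 ?posrE ?invr_gt0.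
  by rewrite ler_pdivrMl //; move: h2; rewrite ler_pdivrMr //; lra.
have key n m : good n -> (0 < m)%N ->
    q (riemann_sum a x n - riemann_sum a x (n * m)) <= e / 4.
  move=> [n0 [ndl nr]] m0.
  have /le_trans : q (riemann_sum a x n - riemann_sum a x (n * m)) <=
      a * e1 + n%:R^-1 * r x.
    apply: riemann_sum_refine => // [d d0 da|d d' d0 da d'0 d'n].
      by apply: Hr => //; lra.
    rewrite semigroupD // -linearB; apply: le_trans (Hr _ _ d0 _) _; first lra.
    by rewrite (rsnBC sr) ltW // Hdl //; exact: le_trans ndl.
  apply; lra.
have [n0 gn0] := filter_ex Hg.
exists (riemann_sum a x n0); apply: filterS Hg => n gn.
(* The meshes 1/n and 1/n0 are compared through their common refinement 1/(n n0). *)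
apply: le_lt_trans (rsn_tri sq (riemann_sum a x (n * n0)) _ _) _.
have h1 := key n n0 gn gn0.1; have h2 := key n0 n gn0 gn.1.
rewrite mulnC in h2; rewrite (rsnBC sq (riemann_sum a x (n * n0))); lra.
Unshelve. all: by end_near. Qed.

(* For a >= 0, the integral of S(r) x over [0, a]. *)
Definition semigroup_integral (a : R) x : X :=
  xget 0 [set y : X | riemann_sum a x @ \oo --> y].

Lemma semigroup_integral_cvg (a : R) x : 0 <= a ->
  riemann_sum a x @ \oo --> semigroup_integral a x.
Proof.
move=> a0; have [y Hy] := riemann_sum_cvg x a0.
by rewrite /semigroup_integral; case: xgetP => [z -> //|/(_ y)].
Qed.

Local Notation I := semigroup_integral.

Lemma semigroup_integral_linear (a : R) (c : K) x y : 0 <= a ->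
  I a (c *: x + y) = c *: I a x + I a y.
Proof.
move=> a0; apply: (tvs_cvg_unique hX (semigroup_integral_cvg a0)).
rewrite (_ : riemann_sum a _ = fun n => c *: riemann_sum a x n + riemann_sum a y n).
  by apply: tvs_cvgD; [apply: tvs_cvgZ|]; exact: semigroup_integral_cvg.
by apply/funext => n; exact: riemann_sum_linear.
Qed.

Lemma semigroup_integralB (a : R) x y : 0 <= a -> I a (x - y) = I a x - I a y.
Proof.
move=> a0; have := semigroup_integral_linear (-1) y x a0.
by rewrite !scaleN1r [- y + x]addrC [- _ + I a x]addrC.
Qed.

Lemma semigroup_integralZ (a : R) (c : K) x : 0 <= a -> I a (c *: x) = c *: I a x.
Proof.
move=> a0; have I0 : I a 0 = 0.
  by have := semigroup_integral_linear (-1) 0 0 a0; rewrite scaler0 addr0 scaleN1r addNr.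
by have := semigroup_integral_linear c x 0 a0; rewrite I0 !addr0.
Qed.

Lemma semigroup_integral_le q (a c : R) x : basic_seminorm p q -> 0 <= a ->
  (forall d, 0 <= d -> d <= a -> q (S d x) <= c) -> q (I a x) <= a * c.
Proof.
move=> hq a0 H; apply: (cvg_seminorm_le hp hq (semigroup_integral_cvg (x := x) a0)).
by apply: nearW => n; exact: riemann_sum_le.
Qed.

Lemma semigroup_integral_average q (a e : R) x : basic_seminorm p q -> 0 <= a ->
  (forall d, 0 <= d -> d <= a -> q (S d x - x) <= e) ->
  q (I a x - of_real a *: x) <= a * e.
Proof.
move=> hq a0 H; have sq := basic_seminormP hp hq.
apply/ler_addgt0Pr => c c0.
have q0 := rsn_ge0 sq x.
pose c' := c / (q x + 1); have c'0 : 0 < c' by rewrite divr_gt0 //; lra.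
have c'q : c' * q x <= c by rewrite /c' mulrAC ler_pdivrMr; [nra|lra].
apply: (cvg_seminorm_le hp hq (tvs_cvgB (semigroup_integral_cvg (x := x) a0) (cvg_cst _))).
have Hn := truncn_step_cvg ler01 a0 c'0.
near=> n; set m := Num.truncn (n%:R * a).
have : 1 * a - c' <= (Num.truncn (n%:R * a))%:R * (1 / n%:R) <= 1 * a by near: n.
rewrite mul1r div1r -/m => /andP[h1 h2].
have -> : riemann_sum a x n - of_real a *: x =
    of_real n%:R^-1 *: \sum_(k < m) (S (k%:R / n%:R) x - x)
    + of_real (m%:R / n%:R - a) *: x.
  have E : of_real n%:R^-1 *: (x *+ m) = of_real (m%:R / n%:R) *: x.
    by rewrite -scaler_nat scalerA -(rmorph_nat of_real) -rmorphM mulrC.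
  by rewrite /riemann_sum sumrB scalerBr sumr_const card_ord E rmorphB scalerBl addrA subrK.
apply: le_trans (rsnD sq _ _) _; rewrite !(rsnZr sq) ger0_norm ?invr_ge0 //.
have h3 : q (\sum_(k < m) (S (k%:R / n%:R) x - x)) <= m%:R * e.
  apply: (rsn_sum_le sq (F := fun k => S (k%:R / n%:R) x - x)) => k km.
  by apply: H; rewrite ?divr_ge0 //; apply: truncn_div_le => //; exact: ltnW.
have e0 : 0 <= e by apply: le_trans (H 0 (lexx 0) a0); exact: (rsn_ge0 sq).
have n0 : 0 <= n%:R^-1 :> R by rewrite invr_ge0.
have h4 := ler_wpM2l n0 h3.
have h5 : m%:R / n%:R * e <= a * e by rewrite ler_wpM2r.
have h6 : `|m%:R / n%:R - a| * q x <= c' * q x.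
  by rewrite ler_wpM2r // ler_norml; apply/andP; split; lra.
have h7 : n%:R^-1 * (m%:R * e) = m%:R / n%:R * e by rewrite mulrA (mulrC _ m%:R).
lra.
Unshelve. all: by end_near. Qed.

(** Either side is 1/n times the sum over l + m grid points minus the sums over l and over m, which
    is symmetric in l and m. *)
Lemma riemann_sum_exchange (a h : R) x n : 
  S ((Num.truncn (n%:R * h))%:R / n%:R) (riemann_sum a x n) - riemann_sum a x n =
  S ((Num.truncn (n%:R * a))%:R / n%:R) (riemann_sum h x n) - riemann_sum h x n.
Proof.
rewrite /riemann_sum; set l := Num.truncn _; set m := Num.truncn _.
pose G j := S (j%:R / n%:R) x.
have shift i j : S (i%:R / n%:R) (\sum_(k < j) G k) =
    \sum_(k < i + j) G k - \sum_(k < i) G k.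
  rewrite linear_sum big_split_ord /= [RHS]addrAC subrr add0r.
  apply: eq_bigr => k _.
  by rewrite /G -semigroupD ?divr_ge0 // -mulrDl -natrD.
have E i j : S (i%:R / n%:R) (of_real n%:R^-1 *: \sum_(k < j) G k)
    - of_real n%:R^-1 *: \sum_(k < j) G k = of_real n%:R^-1 *:
    (\sum_(k < i + j) G k - \sum_(k < i) G k - \sum_(k < j) G k).
  by rewrite linearZ /= shift -scalerBr.
by rewrite (E l m) (E m l) addnC addrAC.
Qed.

Lemma semigroup_riemann_cvg (a h : R) (y : nat -> X) x : 0 <= h -> y @ \oo --> x ->
  (fun n => S ((Num.truncn (n%:R * h))%:R / n%:R) (y n)) @ \oo --> S h x.
Proof.
move=> h0; apply: semigroup_cvg => [n|n|e e0]; first by rewrite divr_ge0.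
  exact: truncn_div_le.
apply: filterS (truncn_step_cvg ler01 h0 e0) => n /andP[].
by rewrite mul1r div1r.
Qed.

(** Divided by h, the right side tends to S a x - x as h tends to 0: integrals lie in the domain of
    the generator. *)
Lemma semigroup_integral_exchange (a h : R) x : 0 <= a -> 0 <= h ->
  S h (I a x) - I a x = S a (I h x) - I h x.
Proof.
move=> a0 h0; have Ia := semigroup_integral_cvg (x := x) a0.
have Ih := semigroup_integral_cvg (x := x) h0.
have := tvs_cvgB (semigroup_riemann_cvg a h0 Ia) Ia.
under eq_fun do rewrite riemann_sum_exchange.
move/(tvs_cvg_unique hX); apply.
exact: tvs_cvgB (semigroup_riemann_cvg a a0 Ih) Ih.
Qed.

Lemma semigroup_integral_commute (a h : R) x : 0 <= a -> 0 <= h ->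
  I a (S h x) = S h (I a x).
Proof.
move=> a0 h0; apply: (tvs_cvg_unique hX (semigroup_integral_cvg a0)).
rewrite (_ : riemann_sum a _ = fun n => S h (riemann_sum a x n)).
  exact: (cvg_bounded_op (G := S h) (semigroup_integral_cvg (x := x) a0)).
apply/funext => n; rewrite /riemann_sum linearZ (linear_sum (S h)) /=.
congr (_ *: _); apply: eq_bigr => k _.
by rewrite -!semigroupD ?divr_ge0 // addrC.
Qed.

End Semigroup.

Lemma subr_split (V : zmodType) (x y u v : V) :
  x - y = u - v + (x - u - (y - v)).
Proof. by rewrite opprB addrA [u - v + _]addrC [x - u + _]addrA subrK addrA subrK. Qed.

Lemma subrACA (V : zmodType) (x y u v : V) : x - y - (u - v) = x - u - (y - v).
Proof.
rewrite !opprB -!addrA; congr (_ + _).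
by rewrite addrCA [RHS]addrCA; congr (_ + _); exact: addrC.
Qed.

Section Generator.
Context (R : realType) (T : scalar_kind) (X : tvsType (scalar_field R T)).
Local Notation K := (scalar_field R T).
Context (Omega : Type) (p : Omega -> X -> K) (hp : generating_seminorms p).
Context (hX : hausdorff_space X) (cX : complete_space X).
Context (S : R -> bounded_op X) (hS : lC0_semigroup p S).
Local Notation I := (semigroup_integral S).

Let integral_linear := semigroup_integral_linear hp hX cX hS.
Let integralB := semigroup_integralB hp hX cX hS.
Let integralZ := semigroup_integralZ hp hX cX hS.
Let integral_commute := semigroup_integral_commute hp hX cX hS.
Let integral_exchange := semigroup_integral_exchange hp hX cX hS.

Lemma generator_near f g q (e : R) : generator S (f, g) -> basic_seminorm p q ->
  0 < e -> exists2 dl : R, 0 < dl & forall h, 0 < h -> h < dl ->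
    q (of_real h^-1 *: (S h f - f) - g) < e.
Proof.
move=> + hq e0; rewrite /generator /strong_derivative0 /=.
move=> /(basic_cvgP hp)/(_ q hq e e0); rewrite /at_right /within /=.
move=> /nbhs_ballP[dl /= dl0 H]; exists dl => // h h0 hd.
have := H h; rewrite (semigroup0 hS) fmorphV; apply => //.
by rewrite /ball /= sub0r normrN gtr0_norm.
Qed.

Lemma generator_of_near f g :
  (forall q, basic_seminorm p q -> forall e : R, 0 < e ->
   exists2 dl : R, 0 < dl & forall h, 0 < h -> h < dl ->
    q (of_real h^-1 *: (S h f - f) - g) < e) -> generator S (f, g).
Proof.
move=> H; apply/(basic_cvgP hp) => q hq e e0; have [dl dl0 Hdl] := H q hq e e0.
rewrite /at_right /within /=; apply/nbhs_ballP; exists dl => //= h.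
rewrite /ball /= sub0r normrN => hd h0; rewrite (semigroup0 hS) -fmorphV.
by apply: Hdl => //; move: hd; rewrite gtr0_norm.
Qed.

Lemma generator_chernoff_graph (t : R) : 0 < t ->
  generator S `<=` chernoff_graph p S t.
Proof.
move=> t0 [f g] Gfg; apply: (chernoff_graph_mef hp t0 (semigroup_E_class hS)).
by exists (fun=> f); [exact: cvg_cst|exact: Gfg].
Qed.

Lemma semigroup_integral_bound q (s : R) : basic_seminorm p q -> 0 <= s ->
  exists2 r, basic_seminorm p r & (forall x, q x <= r x) /\
    forall a x, 0 <= a -> a <= s -> q (I a x) <= a * r x.
Proof.
move=> hq s0; have [r hr [qr Hr]] := semigroup_bound hp hS hq s0.
exists r => //; split=> // a x a0 as_.
apply: (semigroup_integral_le hp cX hS hq a0) => d d0 da.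
by apply: Hr => //; exact: le_trans as_.
Qed.

(** By commutation and exchange, I_a of the difference quotient of f at h equals (S a - 1) applied
    to the average h^-1 I_h f. As h tends to 0 the quotient tends to g and the average to f. *)
Lemma semigroup_integral_generator f g (a : R) : 0 <= a -> generator S (f, g) ->
  I a g = S a f - f.
Proof.
move=> a0 Gfg; apply: (hausdorff_basic_eq hp hX) => q hq e e0.
have sq := basic_seminormP hp hq.
have [r1 hr1 [qr1 Hr1]] := semigroup_integral_bound hq a0.
have [r2 hr2 [qr2 Hr2]] := semigroup_bound hp hS hq a0.
have e3 : 0 < e / 4 by lra.
pose c := e / 4 / (a + 1); have c0 : 0 < c by rewrite divr_gt0 //; lra.
have ac : a * c <= e / 4 by rewrite /c mulrA ler_pdivrMr; [nra|lra].
have [dl dl0 Hdl] := generator_near Gfg hr1 c0.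
have [dl' dl'0 Hdl'] := semigroup_continuous0 hp hS f hr2 e3.
pose h := Num.min dl dl' / 2.
have h0 : 0 < h by rewrite divr_gt0 // lt_min dl0.
have [hd hd'] : h < dl /\ h <= dl'.
  have : Num.min dl dl' <= dl by rewrite ge_min lexx.
  have : Num.min dl dl' <= dl' by rewrite ge_min lexx orbT.
  by move: h0; rewrite /h; split; lra.
have hN0 : (of_real h : K) != 0 by rewrite fmorph_eq0 gt_eqF.
pose z := of_real h^-1 *: I h f - f.
have E : I a (of_real h^-1 *: (S h f - f)) = S a f - f + (S a z - z).
  rewrite integralZ // integralB //.
  rewrite integral_commute ?(ltW h0) // integral_exchange ?(ltW h0) //.
  have Sz : S a z = of_real h^-1 *: S a (I h f) - S a f.
    by rewrite linearB linearZ.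
  by rewrite Sz scalerBr /z; exact: subr_split.
have -> : I a g - (S a f - f) = (S a z - z) - I a (of_real h^-1 *: (S h f - f) - g).
  have Id (x w y : X) : x - w = y - (w + y - x).
    by rewrite opprB opprD (addrA x) [RHS]addrC subrK.
  by rewrite integralB // E; exact: Id.
have zE : r2 z <= e / 4.
  have -> : z = of_real h^-1 *: (I h f - of_real h *: f).
    by rewrite scalerBr scalerA -rmorphM /= mulVf ?gt_eqF // rmorph1 scale1r.
  rewrite (rsnZr (basic_seminormP hp hr2)) gtr0_norm ?invr_gt0 // ler_pdivrMl //.
  apply: (semigroup_integral_average hp cX hS hr2 (ltW h0)) => d d0 dh.
  by apply/ltW/Hdl' => //; exact: le_trans hd'.
apply: le_lt_trans (rsnB sq _ _) _.
have h1 := rsnB sq (S a z) z; have h2 := Hr2 a z a0 (lexx a); have h3 := qr2 z.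
have h4 := Hr1 a (of_real h^-1 *: (S h f - f) - g) a0 (lexx a).
have h5 := ler_wpM2l a0 (ltW (Hdl h h0 hd)).
lra.
Qed.

Lemma generator_invariant f g (s : R) : 0 <= s -> generator S (f, g) ->
  generator S (S s f, S s g).
Proof.
move=> s0 Gfg; apply: generator_of_near => q hq e e0.
have [r hr [qr Hr]] := semigroup_bound hp hS hq s0.
have [dl dl0 H] := generator_near Gfg hr e0; exists dl => // h h0 hd.
rewrite -(semigroupD hS _ (ltW h0) s0) (addrC h s) (semigroupD hS _ s0 (ltW h0)).
rewrite -(linearB (S s)) -linearZ -(linearB (S s)).
by apply: le_lt_trans (Hr _ _ s0 (lexx s)) (H h h0 hd).
Qed.

(** Continuous counterpart of [chernoff_block]: S u g - g is estimated through a nearby a in the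
    domain, where S u a - a is the integral of S(r) b over [0, u]. *)
Lemma generator_increment q (s : R) : basic_seminorm p q -> 0 <= s ->
  exists2 r, basic_seminorm p r & (forall x, q x <= r x) /\
    forall f g a b d, generator S (f, g) -> generator S (a, b) ->
      0 <= d -> d <= s ->
      q (S d f - f - of_real d *: g) <= d * (2 * r (g - a) + d * r b).
Proof.
move=> hq s0; have [r1 hr1 [qr1 Hr1]] := semigroup_bound hp hS hq s0.
have [r2 hr2 [qr2 Hr2]] := semigroup_integral_bound hq s0.
have sq := basic_seminormP hp hq; have sr1 := basic_seminormP hp hr1.
have sr2 := basic_seminormP hp hr2.
exists (fun x => r1 x + r2 x); first exact: basicD.
split=> [x|f g a b d Gfg Gab d0 ds].
  by have := qr1 x; have := rsn_ge0 sr2 x; lra.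
rewrite -(semigroup_integral_generator d0 Gfg).
apply: (semigroup_integral_average hp cX hS hq d0) => u u0 ud.
have -> : S u g - g = (S u (g - a) - (g - a)) + I u b.
  rewrite (semigroup_integral_generator u0 Gab) (linearB (S u)) [RHS]addrC.
  exact: subr_split.
have us : u <= s := le_trans ud ds.
apply: le_trans (rsnD sq _ _) _.
have h1 := rsnB sq (S u (g - a)) (g - a); have h2 := Hr1 u (g - a) u0 us.
have h3 := qr1 (g - a); have h4 := Hr2 u b u0 us.
have h5 : u * r2 b <= d * r2 b by rewrite ler_wpM2r // (rsn_ge0 sr2).
have h6 := rsn_ge0 sr2 (g - a); have h7 : 0 <= d * r1 b by rewrite mulr_ge0 // (rsn_ge0 sr1).
have h8 : d * (r1 b + r2 b) = d * r1 b + d * r2 b by ring.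
rewrite h8; lra.
Qed.

(** For y = I_a x the exchange identity turns S d y - y into S a (I_d x) - I_d x, which is of order
    d uniformly for x in a bounded set. This rate is what the second integration converts into
    strong convergence of the quotients. *)
Lemma semigroup_star_dense : star_dense (domain
  (strong_derivative0 (fun s => adjoint (S s) : dual p -> dual p))).
Proof.
have dual_comp (phi : dual p) (G : X -> X) : linear G ->
    (forall q, basic_seminorm p q -> exists2 r, basic_seminorm p r &
      forall x, q (G x) <= r x) ->
    exists psi : dual p, forall x, psi x = phi (G x).
  move=> lG bG; have hpsi : (fun x => phi (G x) : K^o) \in @continuous_functional K X.
    apply: (functional_dual hp) => [c x y|].
      by rewrite lG dualD dualZ.
    have [q hq phiq] := functional_bounded hp phi.
    have [r hr qr] := bG q hq; exists r => // x; exact: le_trans (phiq _) (qr x).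
  by exists (Dual p hpsi).
move=> phi; pose al k : R := k.+1%:R^-1.
have al0 k : 0 < al k by rewrite invr_gt0.
have al1 k : al k <= 1 by rewrite invf_le1 // ler1n.
pose G k x := of_real ((al k)^-1 * (al k)^-1) *: I (al k) (I (al k) x).
have lG k : linear (G k).
  move=> c x y; have a0 := ltW (al0 k); rewrite /G.
  by rewrite !integral_linear // scalerDr !scalerA mulrC.
have bG k q : basic_seminorm p q -> exists2 r, basic_seminorm p r &
    forall x, q (G k x) <= r x.
  move=> hq; have a0 := ltW (al0 k); have sq := basic_seminormP hp hq.
  have [r1 hr1 [_ Hr1]] := semigroup_integral_bound hq a0.
  have [r2 hr2 [_ Hr2]] := semigroup_integral_bound hr1 a0.
  exists r2 => // x; rewrite (rsnZr sq) ger0_norm ?mulr_ge0 ?invr_ge0 //.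
  rewrite -mulrA ler_pdivrMl // ler_pdivrMl //.
  apply: le_trans (Hr1 _ _ a0 (lexx _)) _; rewrite ler_wpM2l //.
  exact: Hr2.
have /choice[psi psiE] k := dual_comp phi (G k) (lG k) (bG k).
exists psi; split=> [k|x]; last first.
  have [q hq phiq] := functional_bounded hp phi.
  apply/scalar_cvgP => e e0; have e2 : 0 < e / 3 by lra.
  have [r hr [qr Hr]] := semigroup_integral_bound hq ler01.
  have sq := basic_seminormP hp hq.
  have [dl dl0 Hdl] := semigroup_continuous0 hp hS x hr e2.
  near=> k.
  have adl : al k <= dl.
    have h1 : dl^-1 <= k%:R by near: k; exact: nbhs_infty_ger.
    rewrite -[dl]invrK lef_pV2 ?posrE ?invr_gt0 //.
    by apply: le_trans h1 _; rewrite ler_nat.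
  rewrite psiE -dualB; apply: le_lt_trans (phiq _) _.
  have a0 := ltW (al0 k); set a := al k in a0 adl *.
  have an0 : a != 0 by rewrite gt_eqF // al0.
  have Hx d : 0 <= d -> d <= a -> r (S d x - x) < e / 3.
    by move=> d0 da; apply: Hdl => //; exact: le_trans adl.
  have -> : G k x - x = of_real (a^-1 * a^-1) *: (I a (I a x) - of_real a *: I a x)
      + of_real a^-1 *: (I a x - of_real a *: x).
    rewrite !scalerBr !scalerA -!rmorphM /= mulVf // rmorph1 scale1r.
    by rewrite -mulrA mulVf // mulr1 addrA subrK.
  apply: le_lt_trans (rsnD sq _ _) _; rewrite !(rsnZr sq).
  rewrite !ger0_norm ?mulr_ge0 ?invr_ge0 //.
  have h1 : q (I a x - of_real a *: x) <= a * (e / 3).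
    apply: (semigroup_integral_average hp cX hS hq a0) => d d0 da.
    by apply/ltW/(le_lt_trans (qr _)); exact: Hx.
  have h2 : q (I a (I a x) - of_real a *: I a x) <= a * (a * (e / 3)).
    apply: (semigroup_integral_average hp cX hS hq a0) => d d0 da.
    rewrite -(integral_commute _ a0 d0) -integralB //.
    apply: le_trans (Hr a _ a0 (al1 k)) _; rewrite ler_wpM2l // ltW //.
    exact: Hx.
  rewrite -ler_pdivrMl ?al0 // in h1.
  rewrite -ler_pdivrMl ?al0 // -ler_pdivrMl ?al0 // mulrA in h2.
  lra.
have a0 := ltW (al0 k); set a := al k in a0.
(* The derivative of h |-> G_k (S h x) at 0, as predicted by the exchange identity applied to the
   outer integral. *)
pose G' x := of_real (a^-1 * a^-1) *: (S a (I a x) - I a x).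
have lG' : linear G'.
  move=> c x y; rewrite /G' integral_linear // linearP.
  by rewrite opprD addrACA -scalerBr scalerDr !scalerA mulrC.
have bG' q : basic_seminorm p q -> exists2 r, basic_seminorm p r &
    forall x, q (G' x) <= r x.
  move=> hq; have sq := basic_seminormP hp hq.
  have [r1 hr1 [qr1 Hr1]] := semigroup_bound hp hS hq a0.
  have [r2 hr2 [_ Hr2]] := semigroup_integral_bound hr1 a0.
  pose c := a^-1 * a^-1 * 2 * a.
  have c0 : 0 <= c by rewrite !mulr_ge0 ?invr_ge0.
  exists (fun x => c * r2 x); first exact: basicZ.
  move=> x; rewrite (rsnZr sq) ger0_norm ?mulr_ge0 ?invr_ge0 //.
  rewrite /c -!mulrA ler_wpM2l ?invr_ge0 // ler_wpM2l ?invr_ge0 //.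
  apply: le_trans (rsnB sq _ _) _.
  have h1 := Hr1 a (I a x) a0 (lexx a); have h2 := qr1 (I a x).
  have h3 := Hr2 a x a0 (lexx a); lra.
have [psi' psi'E] := dual_comp phi G' lG' bG'.
exists psi'; apply: cvg_dual => A bA e e0.
have [q hq phiq] := functional_bounded hp phi.
have sq := basic_seminormP hp hq.
have [r1 hr1 [qr1 Hr1]] := semigroup_bound hp hS hq ler01.
have sr1 := basic_seminormP hp hr1.
have [r2 hr2 [qr2 Hr2]] := semigroup_bound hp hS hr1 ler01.
have sr2 := basic_seminormP hp hr2.
have [r3 hr3 [qr3 Hr3]] := semigroup_integral_bound hr2 ler01.
(* Boundedness passes to basic seminorms by induction on their construction. A bound [N] is known to
   be real and nonnegative only if A has a point, hence the absolute value of its real part. *)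
have [M M0 HM] : exists2 M : R, 0 <= M & forall x, A x -> r3 x <= M.
  elim: hr3 => {r3 qr3 Hr3} [|r3 al' b hr3 [M M0 HM] b0]; first by exists 0.
  have [N HN] := bA al'.
  exists (M + b * `|real_part N|); first by rewrite addr_ge0 // mulr_ge0.
  move=> x Ax; rewrite lerD ?HM // ler_wpM2l //; apply: le_trans (ler_norm _).
  have [p0 _ _] := hp.1 al'.
  rewrite -(ler_of_real T) !real_partK //; first exact: HN.
  exact: le_trans (p0 x) (HN x Ax).
pose C := a^-1 * a^-1 * (4 * M) + 1.
have C0 : 0 < C by rewrite ltr_wpDl // !mulr_ge0 ?invr_ge0.
near=> h => x Ax.
have h0 : 0 < h by near: h; exact: nbhs_right_gt.
have h1 : h < 1 by near: h; exact: nbhs_right_lt.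
have he : h < e / C by near: h; apply: nbhs_right_lt; rewrite divr_gt0.
have hh0 := ltW h0.
rewrite -[X in modulus X]/((of_real h)^-1 * (psi k (S h x) - psi k (S 0 x)) - psi' x).
rewrite !psiE psi'E (semigroup0 hS) -dualB -dualZ -dualB.
pose y := I a x; pose z := of_real h^-1 *: I h y - y.
have -> : (of_real h)^-1 *: (G k (S h x) - G k x) - G' x =
    of_real (a^-1 * a^-1) *: (S a z - z).
  rewrite /G -/a -scalerBr !integral_commute //.
  rewrite integral_exchange // /G' -/y.
  rewrite -fmorphV scalerA mulrC -scalerA -scalerBr; congr (_ *: _).
  have Sz : S a z = of_real h^-1 *: S a (I h y) - S a y.
    by rewrite linearB linearZ.
  by rewrite Sz /z scalerBr; exact: subrACA.
apply: le_lt_trans (phiq _) _.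
have c0 : 0 <= a^-1 * a^-1 by rewrite mulr_ge0 ?invr_ge0.
rewrite (rsnZr sq) ger0_norm //.
have z1 : r1 z <= 2 * h * M.
  have -> : z = of_real h^-1 *: (I h y - of_real h *: y).
    by rewrite scalerBr scalerA -rmorphM /= mulVf ?gt_eqF // rmorph1 scale1r.
  rewrite (rsnZr sr1) gtr0_norm ?invr_gt0 // ler_pdivrMl //.
  apply: (semigroup_integral_average hp cX hS hr1 hh0) => d d0 dh.
  have d1 : d <= 1 by exact: le_trans dh (ltW h1).
  rewrite integral_exchange //; apply: le_trans (rsnB sr1 _ _) _.
  have h2 := Hr2 a (I d x) a0 (al1 k); have h3 := qr2 (I d x).
  have h4 := Hr3 d x d0 d1; have h5 := HM x Ax.
  have h6 : d * r3 x <= h * M.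
    by apply: ler_pM => //; exact: (rsn_ge0 (basic_seminormP hp hr3)).
  lra.
have h2 := rsnB sq (S a z) z; have h3 := Hr1 a z a0 (al1 k); have h4 := qr1 z.
have h5 : q (S a z - z) <= 4 * M * h by lra.
apply: le_lt_trans (ler_wpM2l c0 h5) _.
move: he; rewrite ltr_pdivlMr // /C; lra.
Unshelve. all: by end_near. Qed.

End Generator.

(** * Convergence of the approximations to a given semigroup *)

Section ChernoffLimit.
Context (R : realType) (T : scalar_kind) (X : tvsType (scalar_field R T)).
Local Notation K := (scalar_field R T).
Context (Omega : Type) (p : Omega -> X -> K) (hp : generating_seminorms p).
Context (hX : hausdorff_space X) (cX : complete_space X) (t : R) (t_gt0 : 0 < t).

Lemma chernoff_seq_semigroup (S : R -> bounded_op X) (s : R) f :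
  lC0_semigroup p S -> 0 <= s -> chernoff_seq S t s f @ \oo --> S (t * s) f.
Proof.
move=> hS s0; have h0 n : 0 <= t / n%:R by rewrite divr_ge0 // ltW.
rewrite (_ : chernoff_seq S t s f =
  fun n => S ((Num.truncn (n%:R * s))%:R * (t / n%:R)) f); last first.
  by apply/funext => n; exact: (semigroup_iter hS).
apply: (semigroup_cvg hp hS) => [n|n|e e0|]; first by rewrite mulr_ge0.
- case: n => [|n].
    by rewrite mul0r truncn0 mul0r; apply: mulr_ge0 => //; exact: ltW.
  by apply: step_le => //; exact: truncn_mul_le.
- by apply: filterS (truncn_step_cvg (ltW t_gt0) s0 e0) => n /andP[].
- exact: cvg_cst.
Qed.

Context (F : R -> bounded_op X) (EF : E_class p F).

(** The solution is known here, so S (d i) f and S (d i) g are the data of [chernoff_blocks], with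
    [generator_increment] controlling the increments. Equicontinuity extends the result from the
    dense domain to every f. *)
Lemma chernoff_cvg (S : R -> bounded_op X) : lC0_semigroup p S ->
  generator S `<=` chernoff_graph p F t -> dense (domain (generator S)) ->
  forall f, (fun n => iter n (F (t / n%:R)) f) @ \oo --> S t f.
Proof.
move=> hS GW dG.
have iterE f n : iter n (F (t / n%:R)) f = chernoff_seq F t 1 f n.
  by rewrite /chernoff_seq mulr1 natrK.
have t0 := ltW t_gt0.
have core f g q (e : R) : generator S (f, g) -> basic_seminorm p q -> 0 < e ->
    \forall n \near \oo, q (chernoff_seq F t 1 f n - S t f) <= e.
  move=> Gfg hq e0.
  have [r1 hr1 [qr1 blocks]] := chernoff_blocks hp t_gt0 EF hq ltr01.
  have [r2 hr2 [r1r2 bound]] := semigroup_bound hp hS hr1 t0.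
  have [r3 hr3 [r2r3 incr]] := generator_increment hp hX cX hS hr2 t0.
  have sr3 := basic_seminormP hp hr3.
  pose eta := e / 4 / (4 * t).
  have eta0 : 0 < eta by rewrite divr_gt0 //; have := t_gt0; lra.
  have etaE : 2 * t * (2 * eta) = e / 4.
    by rewrite /eta mulrC; field; rewrite gt_eqF.
  have [a [b Gab] ga] := (dense_basicP hp _).1 dG g r3 hr3 eta eta0.
  rewrite (rsnBC sr3) in ga.
  have e4 : 0 < e / 4 by lra.
  have [L L0 HL] := exists_mesh t0 (rsn_ge0 sr3 b) e4.
  have L0' : 0 < L%:R :> R by rewrite ltr0n.
  pose tau := t / L%:R; have tau0 : 0 <= tau by rewrite divr_ge0.
  pose d i := i%:R * tau : R.
  have d0 i : 0 <= d i by rewrite mulr_ge0.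
  have dt i : (i <= L)%N -> d i <= t.
    move=> iL; rewrite /d /tau mulrA ler_pdivrMr // mulrC ler_wpM2l //.
    by rewrite ler_nat.
  have dS i : d i.+1 = d i + tau by rewrite /d -natr1 mulrDl mul1r.
  have taut : tau <= t by rewrite -[tau]mul1r; exact: (dt 1%N).
  have key i : (i < L)%N -> [/\ chernoff_graph p F t (S (d i) f, S (d i) g),
      chernoff_graph p F t (S (d i) a, S (d i) b),
      r1 (S (d i) g - S (d i) a) <= eta, r1 (S (d i) b) <= r3 b &
      r1 (S (d i.+1) f - S (d i) f - of_real (t * 1 / L%:R) *: S (d i) g) <=
        t * 1 / L%:R * (2 * eta + t * 1 / L%:R * r3 b)].
    move=> iL; have di := dt i (ltnW iL).
    rewrite mulr1 -/tau; split.
    - exact/GW/(generator_invariant hp hS).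
    - exact/GW/(generator_invariant hp hS).
    - rewrite -linearB; apply: le_trans (bound _ _ (d0 i) di) _.
      by apply: ltW; exact: le_lt_trans (r2r3 _) ga.
    - exact: le_trans (bound _ _ (d0 i) di) (r2r3 _).
    rewrite dS (semigroupD hS) //.
    have -> : S (d i) (S tau f) - S (d i) f - of_real tau *: S (d i) g =
        S (d i) (S tau f - f - of_real tau *: g).
      by rewrite !(linearB (S (d i))) [S _ (_ *: _)]linearZ.
    apply: le_trans (bound _ _ (d0 i) di) _.
    apply: le_trans (incr _ _ _ _ _ Gfg Gab tau0 taut) _.
    by rewrite ler_wpM2l // lerD2r; move: ga; lra.
  have := blocks L (fun i => S (d i) f) (fun i => S (d i) g)
    (fun i => S (d i) a) (fun i => S (d i) b) eta (r3 b) L0 key _ e4.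
  have dL : d L = t by rewrite /d /tau mulrC divfK // gt_eqF.
  have dz : d 0%N = 0 by rewrite /d mul0r.
  apply: filterS => n; rewrite dL dz (semigroup0 hS) mulr1 => /le_trans; apply.
  by rewrite mulrDr etaE; lra.
move=> f; apply/(basic_cvgP hp) => q hq e e0; have sq := basic_seminormP hp hq.
have [r1 hr1 [qr1 Hr1]] := chernoff_seq_le hp t_gt0 EF hq ler01.
have [r2 hr2 [r1r2 Hr2]] := semigroup_bound hp hS hr1 t0.
have sr1 := basic_seminormP hp hr1; have sr2 := basic_seminormP hp hr2.
have e4 : 0 < e / 4 by lra.
have [f' [g' Gf] ff'] := (dense_basicP hp _).1 dG f r2 hr2 _ e4.
have Hn := core f' g' q _ Gf hq e4.
near=> n; rewrite iterE.
have n0 : (0 < n)%N by near: n; exact: nbhs_infty_gt.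
have h1 : q (chernoff_seq F t 1 f' n - S t f') <= e / 4 by near: n.
have h2 := Hr1 n (f - f') 1 n0 ler01 (lexx 1).
have h3 := le_trans (qr1 _) (Hr2 t (f' - f) t0 (lexx t)).
have h4 := r1r2 (f - f'); rewrite (rsnBC sr2 f) in h4.
rewrite /chernoff_seq iter_linearB -/(chernoff_seq _ _ _ _ _) in h2.
rewrite linearB in h3.
have := rsn_tri sq (chernoff_seq F t 1 f' n) (chernoff_seq F t 1 f n) (S t f).
have := rsn_tri sq (S t f') (chernoff_seq F t 1 f' n) (S t f).
move: h2; rewrite -/(chernoff_seq F t 1 f n) -/(chernoff_seq F t 1 f' n); lra.
Unshelve. all: by end_near. Qed.

End ChernoffLimit.

Lemma bounded_op_of_linear (K : numFieldType) (X : tvsType K) (f : X -> X) :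
  linear f -> continuous f -> exists G : bounded_op X, forall x, G x = f x.
Proof.
move=> lf cf.
pose g : {linear X -> X} := HB.pack f (GRing.isLinear.Build _ _ _ _ f lf).
by exists (@BoundedOp K X g cf).
Qed.

(** * The limit semigroup *)

Section LimitSemigroup.
Context (R : realType) (T : scalar_kind) (X : tvsType (scalar_field R T)).
Local Notation K := (scalar_field R T).
Context (Omega : Type) (p : Omega -> X -> K) (hp : generating_seminorms p).
Context (hX : hausdorff_space X) (cX : complete_space X) (t : R) (t_gt0 : 0 < t).
Context (F : R -> bounded_op X) (EF : E_class p F).
Context (dW : dense (domain (chernoff_graph p F t))).

Local Notation P := (chernoff_seq F t).
Local Notation Q n k := (iter k (F (t / n%:R))).

(** On the dense domain of W iterates move with bounded speed by [chernoff_modulus]; equicontinuity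
    extends the smallness, though not the speed, to every x. *)
Lemma chernoff_equicontinuous q x (e : R) : basic_seminorm p q -> 0 < e ->
  exists2 dl : R, 0 < dl & \forall n \near \oo, forall k, k%:R <= n%:R * dl ->
    q (Q n k x - x) <= e.
Proof.
move=> hq e0; have sq := basic_seminormP hp hq.
have [r1 hr1 [qr1 Hr1]] := chernoff_bound hp t_gt0 EF hq ler01.
have [r2 hr2 Hr2] := chernoff_modulus hp t_gt0 EF hq ler01.
have sr1 := basic_seminormP hp hr1; have sr2 := basic_seminormP hp hr2.
have e4 : 0 < e / 4 by lra.
have [f [g Wfg] fx] := (dense_basicP hp _).1 dW x r1 hr1 _ e4.
have Hn := Hr2 f g Wfg _ e4.
pose B := r2 g; have B0 : 0 <= B := rsn_ge0 sr2 g.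
pose M := t * B / (e / 4) + 1; have M1 : 1 <= M.
  by rewrite lerDr divr_ge0 ?mulr_ge0 //; have := t_gt0; lra.
have dl0 : 0 < M^-1 by rewrite invr_gt0; lra.
exists M^-1 => //; near=> n => k kn.
have n0 : (0 < n)%N by near: n; exact: nbhs_infty_gt.
have kn1 : k%:R <= n%:R * 1 :> R.
  by apply: le_trans kn _; rewrite ler_wpM2l // invf_le1 //; lra.
have h1 : q (Q n k f - f) <= e / 4 + k%:R * (t / n%:R) * r2 g.
  by move: {kn} k kn1; near: n.
have h2 : k%:R * (t / n%:R) * r2 g <= e / 4.
  have h := step_le t_gt0 n0 kn.
  apply: le_trans (ler_wpM2r B0 h) _.
  rewrite mulrAC ler_pdivrMr; last lra.
  by rewrite /M mulrDr mulr1 [_ * (_ / _)]mulrC divfK; [lra|apply: lt0r_neq0; lra].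
have h3 := Hr1 n k (x - f) n0 kn1; have h4 := qr1 (x - f).
rewrite (rsnBC sr1 f) in fx.
have -> : Q n k x - x = Q n k (x - f) + ((Q n k f - f) - (x - f)).
  by rewrite iter_linearB [RHS]addrCA; exact: subr_split.
apply: le_trans (rsnD sq _ _) _.
have := rsnB sq (Q n k f - f) (x - f); lra.
Unshelve. all: by end_near. Qed.

Context (near_cauchy : forall f (s : R) q (e : R), 0 <= s -> basic_seminorm p q ->
  0 < e -> exists l, \forall n \near \oo, q (P s f n - l) < e).

(** Time is counted in units of t: this is S(ts) f for the semigroup to be built. *)
Definition chernoff_limit (s : R) f : X := xget 0 [set l : X | P s f @ \oo --> l].

Local Notation U := chernoff_limit.

Lemma chernoff_limit_cvg s f : 0 <= s -> P s f @ \oo --> U s f.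
Proof.
move=> s0; have [|l Hl] := complete_seq_cvg hp cX (u := P s f).
  by move=> q hq e e0; exact: near_cauchy.
by rewrite /chernoff_limit; case: xgetP => [z -> //|/(_ l)].
Qed.

Lemma chernoff_limit_linear s : 0 <= s -> linear (U s).
Proof.
move=> s0 a x y; apply: (tvs_cvg_unique hX (chernoff_limit_cvg s0)).
rewrite (_ : P s _ = fun n => a *: P s x n + P s y n).
  by apply: tvs_cvgD; [apply: tvs_cvgZ|]; exact: chernoff_limit_cvg.
by apply/funext => n; exact: iter_linearP.
Qed.

Lemma chernoff_limit_bound q (s : R) : basic_seminorm p q -> 0 <= s ->
  exists2 r, basic_seminorm p r & (forall x, q x <= r x) /\
    forall d x, 0 <= d -> d <= s -> q (U d x) <= r x.
Proof.
move=> hq s0; have [r hr [qr Hr]] := chernoff_seq_le hp t_gt0 EF hq s0.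
exists r => //; split=> // d x d0 ds.
apply: (cvg_seminorm_le hp hq (chernoff_limit_cvg (f := x) d0)).
by near=> n; apply: Hr => //; near: n; exact: nbhs_infty_gt.
Unshelve. all: by end_near. Qed.

Lemma chernoff_limit0 x : U 0 x = x.
Proof.
apply: (tvs_cvg_unique hX (chernoff_limit_cvg (lexx 0))).
rewrite (_ : P 0 x = fun=> x); first exact: cvg_cst.
by apply/funext => n; exact: chernoff_seq0.
Qed.

Lemma chernoff_limit_continuous0 q x (e : R) : basic_seminorm p q -> 0 < e ->
  exists2 dl : R, 0 < dl & forall d, 0 <= d -> d <= dl -> q (U d x - x) <= e.
Proof.
move=> hq e0; have [dl dl0 H] := chernoff_equicontinuous x hq e0.
exists dl => // d d0 dd.
apply: (cvg_seminorm_le hp hq (tvs_cvgB (chernoff_limit_cvg (f := x) d0) (cvg_cst x))).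
by apply: filterS H => n; apply; exact: truncn_mul_le.
Qed.

(** [n(l + m)] exceeds [nl] + [nm] by j = 0 or 1, and [chernoff_equicontinuous] at the limit y = U m
    x makes the extra step harmless. *)
Lemma chernoff_limitD (l m : R) x : 0 <= l -> 0 <= m -> U (l + m) x = U l (U m x).
Proof.
move=> l0 m0; have lm0 := addr_ge0 l0 m0; set y := U m x.
apply: (tvs_cvg_unique hX (chernoff_limit_cvg (f := x) lm0)).
suff H : (fun n => P (l + m) x n - P l y n) @ \oo --> (0 : X).
  have := tvs_cvgD H (chernoff_limit_cvg (f := y) l0).
  by rewrite add0r; under eq_fun do rewrite subrK.
apply/(basic_cvgP hp) => q hq e e0; have sq := basic_seminormP hp hq.
have [r1 hr1 [qr1 Hr1]] := chernoff_bound hp t_gt0 EF hq l0.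
have [r2 hr2 [qr2 Hr2]] := chernoff_bound hp t_gt0 EF hr1 ler01.
have sr1 := basic_seminormP hp hr1.
have e3 : 0 < e / 3 by lra.
have [dl dl0 H1] := chernoff_equicontinuous y hr1 e3.
have H2 : \forall n \near \oo, r2 (P m x n - y) < e / 3.
  exact: (basic_cvgP hp _ _).1 (chernoff_limit_cvg (f := x) m0) r2 hr2 _ e3.
near=> n; rewrite subr0.
have n0 : (0 < n)%N by near: n; exact: nbhs_infty_gt.
have h1 : forall k, k%:R <= n%:R * dl -> r1 (Q n k y - y) <= e / 3 by near: n.
have h2 : r2 (P m x n - y) < e / 3 by near: n.
have h3 : dl^-1 <= n%:R by near: n; exact: nbhs_infty_ger.
pose a := Num.truncn (n%:R * l); pose b := Num.truncn (n%:R * m).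
pose c := Num.truncn (n%:R * (l + m)).
have nl := truncn_itv (mulr_ge0 (ler0n R n) l0).
have nm := truncn_itv (mulr_ge0 (ler0n R n) m0).
have nlm := truncn_itv (mulr_ge0 (ler0n R n) lm0).
have abc : (a + b <= c)%N.
  rewrite truncn_ge_nat ?mulr_ge0 // natrD mulrDr.
  by case/andP: nl => ? _; case/andP: nm => ? _; exact: lerD.
pose j := (c - (a + b))%N.
have j1 : (j <= 1)%N.
  rewrite leq_subLR -ltnS -(ltr_nat R); case/andP: nlm => h _.
  apply: le_lt_trans h _; case/andP: nl => _; case/andP: nm => _.
  by rewrite -/a -/b addn1 -!natr1 natrD mulrDr; lra.
have cE : c = (a + (j + b))%N by rewrite addnCA subnK.
have -> : P (l + m) x n - P l y n = Q n a (Q n j (P m x n) - y).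
  rewrite [RHS]iter_linearB; congr (_ - _).
  by rewrite /chernoff_seq -/b -/c cE !iterD.
have an : a%:R <= n%:R * l by exact: truncn_mul_le.
have j1' : j%:R <= 1 :> R by rewrite -[leRHS]/(1%:R) ler_nat.
have jn : j%:R <= n%:R * 1 :> R.
  by apply: le_trans j1' _; rewrite mulr1 ler1n.
have jd : j%:R <= n%:R * dl.
  by apply: le_trans j1' _; rewrite -ler_pdivrMr // mul1r.
apply: le_lt_trans (Hr1 n a _ n0 an) _.
have -> : Q n j (P m x n) - y = Q n j (P m x n - y) + (Q n j y - y).
  by rewrite iter_linearB addrA subrK.
apply: le_lt_trans (rsnD sr1 _ _) _.
have h4 := Hr2 n j (P m x n - y) n0 jn; have h5 := h1 j jd.
lra.
Unshelve. all: by end_near. Qed.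

Lemma chernoff_limit_semigroup : exists2 S : R -> bounded_op X,
  lC0_semigroup p S & forall s x, 0 <= s -> S (t * s) x = U s x.
Proof.
have t0 := ltW t_gt0.
(* Clamping r at 0 lets the lemmas on U, stated for nonnegative times, yield an operator for every
   r. *)
pose V r := U (Num.max r 0 / t).
have m0 r : 0 <= Num.max r 0 / t by rewrite divr_ge0 // le_max lexx orbT.
have /choice[S SE] r : exists G : bounded_op X, forall x, G x = V r x.
  have lV : linear (V r) by exact: chernoff_limit_linear.
  pose g : {linear X -> X} := HB.pack (V r) (GRing.isLinear.Build _ _ _ _ (V r) lV).
  apply: bounded_op_of_linear => //.
  apply: (basic_linear_continuous hp (G := g)) => q hq.
  have [r' hr' [_ Hr']] := chernoff_limit_bound hq (m0 r).
  by exists r' => // x; exact: Hr'.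
have SU r x : 0 <= r -> S r x = U (r / t) x by move=> r0; rewrite SE /V max_l.
have S0 x : S 0 x = x by rewrite SU // mul0r chernoff_limit0.
have SD l m x : 0 <= l -> 0 <= m -> S (l + m) x = S l (S m x).
  move=> l0 m1; rewrite !SU ?addr_ge0 // mulrDl.
  by rewrite chernoff_limitD // divr_ge0.
have Sbound q (s : R) : basic_seminorm p q -> 0 <= s ->
  exists2 r, basic_seminorm p r &
    forall d x, 0 <= d -> d <= s -> q (S d x) <= r x.
  move=> hq s0; have st0 : 0 <= s / t by rewrite divr_ge0.
  have [r hr [_ Hr]] := chernoff_limit_bound hq st0.
  exists r => // d x d0 ds; rewrite SU //; apply: Hr; first by rewrite divr_ge0.
  by rewrite ler_wpM2r // invr_ge0.
exists S; last by move=> s x s0; rewrite SU ?mulr_ge0 // mulrAC divff ?mul1r // gt_eqF.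
split=> //; [|by move=> l m l0 m1 x; exact: SD|]; last first.
  split=> // s s0; apply/(basic_equicontinuousP hp) => q hq.
  have [r hr Hr] := Sbound q s hq s0; exists r => // G [d [n [m [d0 n0 _ mdn ->]]]] x.
  rewrite (iter_additive (S := fun r => S r : X -> X)) ?divr_ge0 //.
  by apply: Hr; [rewrite mulr_ge0 // divr_ge0|rewrite mulrA].
apply/subspace_continuousP => s /= s0; apply/cvg_bounded_opP => x.
apply/(basic_cvgP hp) => q hq e e0.
have s10 : 0 <= s + 1 by lra.
have [r hr Hr] := Sbound q _ hq s10; have sr := basic_seminormP hp hr.
have e2 : 0 < e / 2 by lra.
have [dl dl0 Hdl] := chernoff_limit_continuous0 x hr e2.
rewrite /within /=; apply/nbhs_ballP.
exists (Num.min 1 (dl * t)); first by rewrite /= lt_min ltr01 mulr_gt0.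
move=> u; rewrite /ball /= lt_min => /andP[us1 usd] u0.
(* Factoring out the earlier of two times reduces continuity on either side of s to continuity at
   0. *)
have key a b : 0 <= a -> a <= b -> b <= s + 1 -> b - a < dl * t ->
    q (S b x - S a x) < e.
  move=> a0 ab bs bad; have ba0 : 0 <= b - a by rewrite subr_ge0.
  have -> : S b x - S a x = S a (S (b - a) x - x).
    by rewrite (linearB (S a)) -SD // [a + _]addrC subrK.
  have as1 : a <= s + 1 := le_trans ab bs.
  apply: le_lt_trans (Hr _ _ a0 as1) _; rewrite SU //.
  apply: le_lt_trans (Hdl _ _ _) _; first by rewrite divr_ge0.
    by rewrite ler_pdivrMr // ltW.
  lra.
have sq := basic_seminormP hp hq.
move: us1 usd; have [su|us] := leP s u.
  rewrite distrC ger0_norm ?subr_ge0 // => us1 usd; apply: key => //; lra.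
rewrite ger0_norm ?subr_ge0 ?(ltW us) // => us1 usd.
rewrite (rsnBC sq); apply: key => //; [exact: ltW|lra].
Qed.

(** Letting n tend to infinity in [chernoff_block_step] on [0, h/t] gives q (S h f - f - h g) <= h
    (2 r (g - a) + h r b). After division by h, a is taken near g and h small. *)
Lemma chernoff_graph_generator (S : R -> bounded_op X) : lC0_semigroup p S ->
  (forall s x, 0 <= s -> S (t * s) x = U s x) ->
  chernoff_graph p F t `<=` generator S.
Proof.
move=> hS SU [f g] Wfg; apply: (generator_of_near hp hS) => q hq e e0.
have sq := basic_seminormP hp hq.
have [r hr [qr Hr]] := chernoff_block_step hp t_gt0 EF hq ler01.
have sr := basic_seminormP hp hr.
have e8 : 0 < e / 8 by lra.
have [a [b Wab] ga] := (dense_basicP hp _).1 dW g r hr _ e8.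
rewrite (rsnBC sr) in ga; have B0 := rsn_ge0 sr b.
exists (Num.min t (e / 4 / (r b + 1))).
  by rewrite lt_min t_gt0 divr_gt0 //; lra.
move=> h h0; rewrite lt_min => /andP[ht hB].
have hB' : h * r b <= e / 4.
  move: hB; rewrite ltr_pdivlMr; [nra|lra].
pose d := h / t; have d0 : 0 <= d by rewrite divr_ge0 // ltW.
have d1 : d <= 1 by rewrite ler_pdivrMr // mul1r ltW.
have td : t * d = h by rewrite /d mulrC divfK // gt_eqF.
have -> : of_real h^-1 *: (S h f - f) - g =
    of_real h^-1 *: (S h f - f - of_real h *: g).
  by rewrite [in RHS]scalerBr scalerA -rmorphM /= mulVf ?gt_eqF // rmorph1 scale1r.
rewrite (rsnZr sq) gtr0_norm ?invr_gt0 // ltr_pdivrMl //.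
apply: (@le_lt_trans _ _ (h * (e / 2))); last by rewrite ltr_pM2l //; lra.
rewrite -[in S h]td SU //.
apply/ler_addgt0Pr => c c0.
apply: (cvg_seminorm_le hp hq (tvs_cvgB (tvs_cvgB
  (chernoff_limit_cvg (f := f) d0) (cvg_cst f)) (cvg_cst (of_real h *: g)))).
have := Hr _ _ _ _ Wfg Wab _ _ (lexx 0) d0 d1 _ c0.
apply: filterS => n; rewrite subr0 td mulr0 truncn0 subn0 => /le_trans; apply.
by rewrite lerD2r ler_wpM2l ?(ltW h0) //; lra.
Qed.

End LimitSemigroup.

(** * A core of the generator *)

Section Core.
Context (R : realType) (T : scalar_kind) (X : tvsType (scalar_field R T)).
Local Notation K := (scalar_field R T).
Context (Omega : Type) (p : Omega -> X -> K) (hp : generating_seminorms p).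
Context (hX : hausdorff_space X) (cX : complete_space X).
Context (S : R -> bounded_op X) (hS : lC0_semigroup p S).
Local Notation I := (semigroup_integral S).

Lemma closure_approx (Z : set (X * X)) f g :
  (forall q, basic_seminorm p q -> forall e : R, 0 < e ->
    exists f' g', [/\ closure Z (f', g'), q (f' - f) < e & q (g' - g) < e]) ->
  closure Z (f, g).
Proof.
by move=> /(basic_closureP hp); rewrite -(closure_id _).1 //; exact: closed_closure.
Qed.

(* For f in A the pair (I a f, S a f - f) is a limit of Riemann sums of pairs
   (S r f, S r g); by density this extends to every f, and letting a tend to 0
   exhausts the generator. *)
Lemma generator_core (Z : set (X * X)) (A : set X) : is_subspace Z ->
  Z `<=` generator S -> A `<=` domain Z -> dense A ->
  (forall f g r, A f -> Z (f, g) -> 0 <= r -> closure Z (S r f, S r g)) ->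
  generator S `<=` closure Z.
Proof.
move=> subZ ZG AZ dA inv.
have [Z0 ZD] := closure_subspace hp subZ.
have step1 f g (a : R) : A f -> Z (f, g) -> 0 <= a -> closure Z (I a f, S a f - f).
  move=> Af Zfg a0.
  rewrite -(semigroup_integral_generator hp hX cX hS a0 (ZG _ Zfg)).
  apply: closure_approx => q hq e e0.
  have cf : \forall n \near \oo, q (riemann_sum S a f n - I a f) < e.
    exact: (basic_cvgP hp _ _).1 (semigroup_integral_cvg hp cX hS a0) q hq e e0.
  have cg : \forall n \near \oo, q (riemann_sum S a g n - I a g) < e.
    exact: (basic_cvgP hp _ _).1 (semigroup_integral_cvg hp cX hS a0) q hq e e0.
  have [n [nf ng]] := filter_ex (filterI cf cg).
  exists (riemann_sum S a f n), (riemann_sum S a g n); split=> //.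
  rewrite /riemann_sum; elim: (Num.truncn _) => [|m IH].
    by rewrite !big_ord0 !scaler0.
  rewrite !big_ord_recr /= !scalerDr ![_ + _ *: S _ _]addrC.
  apply: (ZD _ (S (m%:R / n%:R) f, S (m%:R / n%:R) g) (_, _) _ IH).
  by apply: inv => //; rewrite divr_ge0.
have step2 f (a : R) : 0 <= a -> closure Z (I a f, S a f - f).
  move=> a0; apply: closure_approx => q hq e e0.
  have sq := basic_seminormP hp hq.
  have [r1 hr1 [_ Hr1]] := semigroup_integral_bound hp cX hS hq a0.
  have [r2 hr2 [qr2 Hr2]] := semigroup_bound hp hS hq a0.
  have sr1 := basic_seminormP hp hr1; have sr2 := basic_seminormP hp hr2.
  pose c := e / 3 / (a + 1); have c0 : 0 < c by rewrite !divr_gt0 //; lra.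
  have ac : a * c <= e / 3 by rewrite /c mulrA ler_pdivrMr; [nra|lra].
  have ce : c <= e / 3 by rewrite ler_pdivrMr; [nra|lra].
  have [f' Af' ff'] := (dense_basicP hp _).1 dA f _ (basicD hr1 hr2) c c0.
  have [g' Zfg] := AZ _ Af'.
  have h1 := rsn_ge0 sr1 (f' - f); have h2 := rsn_ge0 sr2 (f' - f).
  exists (I a f'), (S a f' - f'); split; first exact: step1 Zfg a0.
    rewrite -(semigroup_integralB hp hX cX hS) //.
    apply: le_lt_trans (Hr1 a (f' - f) a0 (lexx a)) _.
    apply: (@le_lt_trans _ _ (a * c)); last lra.
    by rewrite ler_wpM2l //; lra.
  have -> : S a f' - f' - (S a f - f) = S a (f' - f) - (f' - f).
    by rewrite (linearB (S a)); exact: subrACA.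
  apply: le_lt_trans (rsnB sq _ _) _.
  have := Hr2 a (f' - f) a0 (lexx a); have := qr2 (f' - f); lra.
move=> [f g] Gfg; apply: closure_approx => q hq e e0.
have sq := basic_seminormP hp hq.
have [dl dl0 Hdl] := generator_near hp hS Gfg hq e0.
have e2 : 0 < e / 2 by lra.
have [dl' dl'0 Hdl'] := semigroup_continuous0 hp hS f hq e2.
pose h := Num.min dl dl' / 2.
have h0 : 0 < h by rewrite divr_gt0 // lt_min dl0.
have [hd hd'] : h < dl /\ h <= dl'.
  have : Num.min dl dl' <= dl by rewrite ge_min lexx.
  have : Num.min dl dl' <= dl' by rewrite ge_min lexx orbT.
  by move: h0; rewrite /h; split; lra.
exists (of_real h^-1 *: I h f), (of_real h^-1 *: (S h f - f)); split.
- have := ZD (of_real h^-1) _ _ (step2 f h (ltW h0)) Z0.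
  by rewrite addr0.
- have -> : of_real h^-1 *: I h f - f = of_real h^-1 *: (I h f - of_real h *: f).
    by rewrite scalerBr scalerA -rmorphM /= mulVf ?gt_eqF // rmorph1 scale1r.
  rewrite (rsnZr sq) gtr0_norm ?invr_gt0 // ltr_pdivrMl //.
  apply: (@le_lt_trans _ _ (h * (e / 2))); last by rewrite ltr_pM2l //; lra.
  apply: (semigroup_integral_average hp cX hS hq (ltW h0)) => d d0 dh.
  by apply/ltW/Hdl' => //; exact: le_trans hd'.
- exact: Hdl.
Qed.

End Core.

(** * The two implications and the limit formula *)

Lemma dense_superset (Y : topologicalType) (A B : set Y) : A `<=` B -> dense A -> dense B.
Proof.
by move=> AB dA O O0 oO; have [x [Ox Ax]] := dA O O0 oO; exists x; split=> //; exact: AB.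
Qed.

Lemma domain_subset (E : Type) (Z Z' : set (E * E)) : Z `<=` Z' ->
  domain Z `<=` domain Z'.
Proof. by move=> ZZ' f [g Zfg]; exists g; exact: ZZ'. Qed.

Theorem corollary8p1 (R : realType) (T : scalar_kind) (X : tvsType (scalar_field R T))
    (Omega : Type) (p : Omega -> X -> scalar_field R T) (Z : set (X * X)) (t : R)
    (hp : generating_seminorms p)
    (hausX : hausdorff_space X) (complX : complete_space X)
    (linZ : linear_operator Z) (densZ : dense (domain Z)) (t_gt0 : 0 < t) :
  let i_to_iv (F : R -> bounded_op X) : Prop :=
    [/\ forall g h, Z (g, h) -> mef_domain F g /\ ef_derivative0 F g = h,
        star_dense (domain
          (strong_derivative0 (fun s => adjoint (F s) : dual p -> dual p))),
        forall (s : R) (f : X), 0 < s ->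
          forall sigma, subsequence_index sigma ->
          exists tau l, subsequence_index tau /\
            weak_cvg p (fun k => chernoff_seq F t s f (sigma (tau k))) l
      & exists A : set X,
          [/\ is_subspace A, A `<=` domain Z, dense A &
            forall (f g : X) (s : R), A f -> Z (f, g) -> 0 <= s ->
            exists f_ g_ : nat -> X,
              [/\ forall n, closure Z (f_ n, g_ n),
                  weak_cvg p (fun n => chernoff_seq F t s f n - f_ n) 0
                & weak_cvg p (fun n => chernoff_seq F t s g n - g_ n) 0]]] in
  ((closable Z /\
    exists S : R -> bounded_op X, lC0_semigroup p S /\ generator S = closure Z)
   <-> exists F : R -> bounded_op X, F_class p F /\ i_to_iv F) /\
  (forall F : R -> bounded_op X, F_class p F -> i_to_iv F ->
   forall S : R -> bounded_op X, lC0_semigroup p S -> generator S = closure Z ->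
   forall f : X, (fun n => iter n (F (t / n%:R)) f) @ \oo --> S t f).
Proof.
have [subZ _] := linZ.
have dom_cl : domain Z `<=` domain (closure Z).
  by apply: domain_subset; exact: subset_closure.
move=> i_to_iv.
have Zgraph F : E_class p F -> i_to_iv F -> closure Z `<=` chernoff_graph p F t.
  move=> EF [ef _ _ _]; apply: (closure_chernoff_graph hp t_gt0 EF) => -[g h] Zgh.
  apply: (chernoff_graph_mef hp t_gt0 EF); have [[h' Hh'] <-] := ef g h Zgh.
  exact: (xgetPex 0 (ex_intro _ h' Hh')).
split; last first.
  move=> F [EF _] iF S hS gS f.
  apply: (chernoff_cvg hp hausX complX t_gt0 EF hS); rewrite gS.
    exact: Zgraph.
  exact: dense_superset dom_cl densZ.
split=> [[_ [S [hS gS]]]|[F [[EF _] iF]]].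
  have ES := semigroup_E_class hS.
  have GW := generator_chernoff_graph hp hS t_gt0.
  have ZG : Z `<=` generator S by rewrite gS; exact: subset_closure.
  have dW : dense (domain (chernoff_graph p S t)).
    by apply: dense_superset densZ; apply: domain_subset; exact: subset_trans GW.
  have mefZ g h : Z (g, h) -> mef_derivative0 (fun s => S s : X -> X) g h.
    by move=> /ZG Ggh; exists (fun=> g); [exact: cvg_cst|exact: Ggh].
  (* [ef_derivative0] is a choice made by [xget]; single-valuedness of W identifies the chosen value
     with h. *)
  have mef_unique g h h' : mef_derivative0 (fun s => S s : X -> X) g h ->
      mef_derivative0 (fun s => S s : X -> X) g h' -> h = h'.
    move=> /(chernoff_graph_mef hp t_gt0 ES) W /(chernoff_graph_mef hp t_gt0 ES) W'.
    have := chernoff_graphB hp W W'; rewrite subrr.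
    move=> /(chernoff_graph_functional hp t_gt0 ES hausX dW)/eqP.
    by rewrite subr_eq0 => /eqP.
  have cvgS (s : R) f : 0 <= s -> chernoff_seq S t s f @ \oo --> S (t * s) f.
    exact: (chernoff_seq_semigroup hp t_gt0 hS).
  exists S; split.
    split=> //; apply: dense_superset densZ => g [h Zgh].
    by exists h; exact: mefZ.
  split.
  - move=> g h Zgh; have mgh := mefZ g h Zgh; split; first by exists h.
    by apply: (mef_unique g) (mgh); exact: (xgetPex 0 (ex_intro _ h mgh)).
  - exact: (semigroup_star_dense hp hausX complX hS).
  - move=> s f s0 sigma hsigma; exists id, (S (t * s) f); split=> //.
    apply: (weak_cvg_subseq hsigma); apply: cvg_weak_cvg.
    exact: cvgS (ltW s0).
  (* For F = S the iterates of f stay in the domain of the generator, which is the closure of Z;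
     they serve as f_n^s themselves and both differences vanish. *)
  - exists (domain Z); split=> //.
      split; first by exists 0; exact: subZ.1.
      by move=> a u v [u' Zu] [v' Zv]; exists (a *: u' + v'); exact: subZ.2 _ _ _ Zu Zv.
    move=> f g s _ Zfg s0; exists (chernoff_seq S t s f), (chernoff_seq S t s g).
    have cvg0 h : weak_cvg p (fun n => chernoff_seq S t s h n - chernoff_seq S t s h n) 0.
      by apply: cvg_weak_cvg; under eq_fun do rewrite subrr; exact: cvg_cst.
    split=> // n; rewrite -gS /chernoff_seq.
    have tn : 0 <= t / n%:R by rewrite divr_ge0 // ltW.
    rewrite !(semigroup_iter hS) //; apply: (generator_invariant hp hS).
      by rewrite mulr_ge0.
    exact: ZG.
have clZW := Zgraph F EF iF.
have ZW : Z `<=` chernoff_graph p F t by apply: subset_trans clZW; exact: subset_closure.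
have dW : dense (domain (chernoff_graph p F t)).
  by apply: dense_superset densZ; exact: domain_subset.
have [_ _ compF [A [subA AZ dA invF]]] := iF.
(* Equicontinuity extends the property from A to X, with the point [l] found for a nearby f' in
   A. *)
have near_cauchy f (s : R) q (e : R) : 0 <= s -> basic_seminorm p q -> 0 < e ->
    exists l, \forall n \near \oo, q (chernoff_seq F t s f n - l) < e.
  move=> s0 hq e0; have sq := basic_seminormP hp hq.
  have [r hr [qr Hr]] := chernoff_seq_le hp t_gt0 EF hq s0.
  have e2 : 0 < e / 2 by lra.
  have [f' Af' ff'] := (dense_basicP hp _).1 dA f r hr _ e2.
  have [l Hl] := chernoff_seq_near_cauchy hp hausX t_gt0 EF compF subZ ZW AZ dA invF
    Af' s0 hq e2.
  exists l; near=> n.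
  have n0 : (0 < n)%N by near: n; exact: nbhs_infty_gt.
  have h1 : q (chernoff_seq F t s f' n - l) < e / 2 by near: n.
  have h2 : q (chernoff_seq F t s (f - f') n) <= r (f - f') by exact: Hr.
  have -> : chernoff_seq F t s f n - l =
      chernoff_seq F t s (f - f') n + (chernoff_seq F t s f' n - l).
    by rewrite {2}/chernoff_seq iter_linearB addrA subrK.
  apply: le_lt_trans (rsnD sq _ _) _.
  by rewrite (rsnBC (basic_seminormP hp hr)) in h2; lra.
have [S hS SU] :=
  chernoff_limit_semigroup hp hausX complX t_gt0 EF dW near_cauchy.
have WG := chernoff_graph_generator hp complX t_gt0 EF dW near_cauchy hS SU.
have clZG : closure Z `<=` generator S by exact: subset_trans WG.
split.
  split; first exact: (closure_subspace hp subZ).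
  move=> f g h Zfg Zfh.
  have := chernoff_graphB hp (clZW _ Zfg) (clZW _ Zfh); rewrite subrr.
  move=> /(chernoff_graph_functional hp t_gt0 EF hausX dW)/eqP.
  by rewrite subr_eq0 => /eqP.
exists S; split=> //; apply/seteqP; split=> //.
(* The required invariance is condition (iv) at s = r/t: by strong convergence the whole sequences
   tend weakly to S r f and S r g. *)
apply: (generator_core hp hausX complX hS subZ _ AZ dA) => [|f g r Af Zfg r0].
  by apply: subset_trans clZG; exact: subset_closure.
have s0 : 0 <= r / t by rewrite divr_ge0 // ltW.
have rE : t * (r / t) = r by rewrite mulrC divfK // gt_eqF.
have cvgU x : weak_cvg p (chernoff_seq F t (r / t) x) (S r x).
  rewrite -{2}rE SU //; apply: cvg_weak_cvg.
  exact: (chernoff_limit_cvg hp complX near_cauchy s0).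
exact: (weak_limit_closure hp subZ invF (tau := id) Af Zfg s0 _ (cvgU f) (cvgU g)).
Unshelve. all: by end_near. Qed.
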